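(* Let $K$ be a finite strongly connected oriented two-dimensional simplicial complex and let $P:K\to\mathbb{R}^3$ be an oriented polyhedron with nondegenerate triangular faces. Let $K_1$ be the set of 1-dimensional simplices of $K$ and, for $\sigma\in K_1$, let $\ell_\sigma$ be the length of the edge $P(\sigma)$. Suppose that the edge lengths of $P$ are $\mathbb{Q}$-linearly independent, i.e., the family $(\ell_\sigma)_{\sigma\in K_1}$ of real numbers is linearly independent over $\mathbb{Q}$. Then $P$ is rigid.
   Context: **Complexes.** A non-empty finite set $K$ of simplices in a Euclidean space is a *finite strongly connected two-dimensional simplicial complex* if: (i) each face of a simplex in $K$ is in $K$; (ii) the intersection of any two simplices of $K$ is a face of each of them; (iii) each simplex of $K$ is contained in a 2-dimensional simplex of $K$; (iv) every 1-dimensional simplex of $K$ is contained in exactly two 2-dimensional simplices of $K$; (v) for any two 2-dimensional simplices $\sigma,\tau\in K$ there is a sequence of 2-dimensional simplices $\sigma=\sigma_1,\dots,\sigma_n=\tau$ of $K$ such that $\sigma_j\cap\sigma_{j+1}$ is a 1-dimensional simplex of $K$ for all $j=1,\dots,n-1$. $K_i$ denotes the set of $i$-dimensional simplices of $K$. $K$ is *oriented* if each of its 2-dimensional simplices is equipped with an orientation and these are consistent: whenever $\sigma\in K_1$ is contained in two distinct $\tau_1,\tau_2\in K_2$, they induce opposite orientations on $\sigma$. **Polyhedra.** A *polyhedron* of combinatorial type $K$ is a mapping $P:K\to\mathbb{R}^3$ (i.e. a map defined on the union of the simplices of $K$) whose restriction to each simplex of $K$ is affine; self-intersections are allowed. For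 $\sigma\in K_i$, $P(\sigma)$ is called a vertex, edge or face of $P$ for $i=0,1,2$ respectively. $P$ has *nondegenerate (triangular) faces* if $P(\sigma)$ is a nondegenerate 2-dimensional simplex for every $\sigma\in K_2$. If $K$ is oriented, $P$ is called *oriented*. **Flexes and rigidity.** A *flex* of $P$ is a continuous family $\{P_t\}_{t\in[0,1]}$ of polyhedra $P_t:K\to\mathbb{R}^3$ with $P_0=P$ such that for every $\sigma\in K_2$ and $t\in(0,1]$ the face $P_t(\sigma)$ is congruent to $P_0(\sigma)$. A flex is *trivial* if for every $t\in(0,1]$ there is an isometry $A_t:\mathbb{R}^3\to\mathbb{R}^3$ with $P_t=A_t\circ P_0$; otherwise it is *nontrivial*. $P$ is *flexible* if it has a nontrivial flex, and *rigid* if every flex of $P$ is trivial. *)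

(* Defs.v *)
(* MathComp-Analysis development, over an arbitrary R : realType. *)
From HB Require Import structures.
From mathcomp Require Import all_boot all_order all_algebra.
From mathcomp Require Import finmap.
From mathcomp Require Import all_classical all_reals all_analysis.
Set Implicit Arguments.
Unset Strict Implicit.
Unset Printing Implicit Defensive.
Import Order.TTheory GRing.Theory Num.Theory.
Import numFieldNormedType.Exports.

Local Open Scope classical_set_scope.
Local Open Scope ring_scope.

(* The library norm on 'rV[R]_n is the sup norm, which induces the right
   topology but not the Euclidean metric. *)
Definition euclidean_dist (R : realType) (n : nat) (x y : 'rV[R]_n) : R :=
  Num.sqrt (\sum_(i < n) (x 0 i - y 0 i) ^+ 2).

Definition is_isometry (R : realType) (n : nat) (A : 'rV[R]_n -> 'rV[R]_n) : Prop :=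
  forall x y, euclidean_dist (A x) (A y) = euclidean_dist x y.

Definition congruent (R : realType) (n : nat) (X Y : set 'rV[R]_n) : Prop :=
  exists2 A : 'rV[R]_n -> 'rV[R]_n, is_isometry A & A @` X = Y.

(* A simplex is encoded by the finite set of its vertices; the simplex as a
   subset of R^n is [hull s], and its faces are the [hull t] with t a subset
   of s (hull fset0 = set0 being the empty face). *)
Definition hull (R : realType) (n : nat) (s : {fset 'rV[R]_n}) : set 'rV[R]_n :=
  [set x | exists w : 'rV[R]_n -> R,
     [/\ forall v, v \in s -> 0 <= w v,
         \sum_(v <- s) w v = 1
       & \sum_(v <- s) w v *: v = x]].

Definition affinely_independent (R : realType) (n : nat) (s : {fset 'rV[R]_n}) : Prop :=
  forall w : 'rV[R]_n -> R,
    \sum_(v <- s) w v = 0 -> \sum_(v <- s) w v *: v = 0 ->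
    forall v, v \in s -> w v = 0.

Definition nondegenerate_triangle (R : realType) (n : nat) (X : set 'rV[R]_n) : Prop :=
  exists s : {fset 'rV[R]_n},
    [/\ #|` s|%fset = 3%N, affinely_independent s & X = hull s].

(* K_i; in a complex every i-dimensional simplex has i + 1 vertices *)
Definition simplices (R : realType) (n : nat) (K : {fset {fset 'rV[R]_n}}) (i : nat) :
    {fset {fset 'rV[R]_n}} :=
  [fset s in K | #|` s|%fset == i.+1]%fset.

Definition body (R : realType) (n : nat) (K : {fset {fset 'rV[R]_n}}) : set 'rV[R]_n :=
  [set x | exists2 s, s \in K & hull s x].

Definition share_edge (R : realType) (n : nat) (K : {fset {fset 'rV[R]_n}}) :
    rel {fset 'rV[R]_n} :=
  fun s t => (s `&` t)%fset \in simplices K 1.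

Record strongly_connected_2complex (R : realType) (n : nat)
    (K : {fset {fset 'rV[R]_n}}) : Prop := {
  complex_nonempty : K <> fset0;
  complex_simplex : forall s, s \in K -> s <> fset0 /\ affinely_independent s;
  complex_face : forall s t : {fset 'rV[R]_n},
    s \in K -> (t `<=` s)%fset -> t <> fset0 -> t \in K;
  complex_meet : forall s t, s \in K -> t \in K ->
    exists u : {fset 'rV[R]_n},
      [/\ (u `<=` s)%fset, (u `<=` t)%fset & hull s `&` hull t = hull u];
  complex_pure : forall s, s \in K ->
    exists2 t, t \in simplices K 2 & (s `<=` t)%fset;
  complex_edge : forall s, s \in simplices K 1 ->
    #|` [fset t in simplices K 2 | (s `<=` t)%fset]|%fset = 2%N;
  complex_connected : forall s t, s \in simplices K 2 -> t \in simplices K 2 ->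
    exists p : seq {fset 'rV[R]_n},
      [/\ {subset p <= simplices K 2}, path (share_edge K) s p & last s p = t] }.

(* An orientation of a triangle is a cyclic ordering of its three vertices,
   given by a duplicate-free list [o t] up to rotation; [next (o t) x = y]
   means that it induces on the edge {x, y} the direction from x to y. *)
Record consistent_orientation (R : realType) (n : nat) (K : {fset {fset 'rV[R]_n}})
    (o : {fset 'rV[R]_n} -> seq 'rV[R]_n) : Prop := {
  orientation_vertices : forall t, t \in simplices K 2 -> uniq (o t) /\ o t =i t;
  orientation_opposite : forall (x y : 'rV[R]_n) (t1 t2 : {fset 'rV[R]_n}),
    [fset x; y]%fset \in simplices K 1 ->
    t1 \in simplices K 2 -> t2 \in simplices K 2 -> t1 <> t2 ->
    ([fset x; y] `<=` t1)%fset -> ([fset x; y] `<=` t2)%fset ->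
    next (o t1) x = y -> next (o t2) y = x }.

Definition affine_on (R : realType) (n m : nat) (D : set 'rV[R]_n)
    (f : 'rV[R]_n -> 'rV[R]_m) : Prop :=
  forall (x y : 'rV[R]_n) (t : R), D x -> D y -> 0 <= t <= 1 ->
    f ((1 - t) *: x + t *: y) = (1 - t) *: f x + t *: f y.

(* Polyhedra are total functions of which only the values on [body K] matter. *)
Definition polyhedron (R : realType) (n : nat) (K : {fset {fset 'rV[R]_n}})
    (P : 'rV[R]_n -> 'rV[R]_3) : Prop :=
  forall s, s \in K -> affine_on (hull s) P.

Definition nondegenerate_faces (R : realType) (n : nat) (K : {fset {fset 'rV[R]_n}})
    (P : 'rV[R]_n -> 'rV[R]_3) : Prop :=
  forall s, s \in simplices K 2 -> nondegenerate_triangle (P @` hull s).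

(* For an edge s the list [enum_fset s] consists of its two endpoints; their
   order is irrelevant because [euclidean_dist] is symmetric. *)
Definition edge_length (R : realType) (n : nat) (P : 'rV[R]_n -> 'rV[R]_3)
    (s : {fset 'rV[R]_n}) : R :=
  euclidean_dist (P (enum_fset s)`_0) (P (enum_fset s)`_1).

Definition Q_independent_edge_lengths (R : realType) (n : nat)
    (K : {fset {fset 'rV[R]_n}}) (P : 'rV[R]_n -> 'rV[R]_3) : Prop :=
  forall c : {fset 'rV[R]_n} -> rat,
    \sum_(s <- simplices K 1) ratr (c s) * edge_length P s = 0 ->
    forall s, s \in simplices K 1 -> c s = 0.

Record flex (R : realType) (n : nat) (K : {fset {fset 'rV[R]_n}})
    (P : 'rV[R]_n -> 'rV[R]_3) (Pt : R -> 'rV[R]_n -> 'rV[R]_3) : Prop := {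
  flex_polyhedron : forall t : R, 0 <= t <= 1 -> polyhedron K (Pt t);
  flex_continuous :
    {within [set t : R | 0 <= t <= 1] `*` body K,
      continuous (fun z : R * 'rV[R]_n => Pt z.1 z.2)};
  flex_start : forall x, body K x -> Pt 0 x = P x;
  flex_congruent : forall (s : {fset 'rV[R]_n}) (t : R),
    s \in simplices K 2 -> 0 < t <= 1 ->
    congruent (Pt 0 @` hull s) (Pt t @` hull s) }.

Definition trivial_flex (R : realType) (n : nat) (K : {fset {fset 'rV[R]_n}})
    (Pt : R -> 'rV[R]_n -> 'rV[R]_3) : Prop :=
  forall t : R, 0 < t <= 1 ->
    exists2 A : 'rV[R]_3 -> 'rV[R]_3, is_isometry A &
      forall x, body K x -> Pt t x = A (Pt 0 x).

Definition rigid (R : realType) (n : nat) (K : {fset {fset 'rV[R]_n}})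
    (P : 'rV[R]_n -> 'rV[R]_3) : Prop :=
  forall Pt : R -> 'rV[R]_n -> 'rV[R]_3, flex K P Pt -> trivial_flex K Pt.

(* Main.v *)
From HB Require Import structures.
Require Import Defs.
From mathcomp Require Import all_boot all_order all_algebra all_field.
From mathcomp Require Import finmap polyXY complex ring lra.
From mathcomp Require Import all_classical all_reals all_analysis.
Set Implicit Arguments.
Unset Strict Implicit.
Unset Printing Implicit Defensive.
Import Order.TTheory GRing.Theory Num.Theory.
Import numFieldNormedType.Exports.
Local Open Scope classical_set_scope.
Local Open Scope ring_scope.

(** The proof shows that all dihedral angles stay constant during a flex.

    A derivation of the field of complex numbers that kills the edge lengths turns
    a configuration with these lengths into an infinitesimal flex, in which each
    face f has an angular velocity w_f. Across an edge e of length l_e, directed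
    by the unit vector u_e, the angular velocities of the two faces differ by the
    derivative of the dihedral angle times u_e. Hence the sum of l_e times the
    derivative of the dihedral angle at e is a sum over the faces of the inner
    product of w_f with the sum of the oriented sides of f, which is 0
    ([sum_dlog_hinge_number]). In terms of the complex numbers U_e that have the
    dihedral angles as arguments and constant moduli ([hinge_number]), the sum of
    l_e * dU_e / U_e vanishes for every such derivation.

    The l_e being linearly independent over Q, this forces each U_e to be algebraic
    over the field A generated by the lengths ([dlog_relation_algebraic]).
    Geometrically, on a curve of configurations the residue of dU_e / U_e at a
    point is the order of U_e there, an integer, so the residue of the relation
    is an integer relation between the lengths; hence the U_e have no zeros and
    poles, and are constant. Algebraically, suppose that x = U_e is transcendental
    over A. Zorn's lemma gives a subfield F containing A such that x is a
    transcendence basis of the complex numbers over F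
    ([exists_transcendence_base]). The derivation d/dx of F(x) extends to all
    complex numbers ([derivation_extension]). Taking norms down to F(x) keeps the
    relation and replaces x by a positive power of x ([dlog_relation_norm]), and the
    residue at x = 0 is the forbidden relation ([residue_dlog]).

    The field A is countable, and so is the set of numbers algebraic over it. So
    the continuous functions U_e take countably many values along the flex and
    are constant ([flex_hinge_constant]). Finally, a face, the hinge number at one
    of its edges, and the shape of the adjacent face determine the latter, so
    that one rigid motion carries all faces from time 0 to time t
    ([flex_motion_step]).

    A congruence of faces only maps one face onto the other as a set. That it
    respects each single edge length follows by continuity, because extreme points
    go to extreme points ([congruent_triangle_vertices], [flex_sqdist]). *)

(** * Subfields and algebraic elements *)

Section Subfields.
Variable L : fieldType.

(** Subfields appear as sets, which can be compared and united along chains, and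
    as types, which carry polynomials; [is_subfieldP] passes from the former to
    the latter. *)
Definition is_subfield (A : set L) : Prop :=
  [/\ A 1, forall x y, A x -> A y -> A (x - y)
         & forall x y, A x -> A y -> A (x / y)].

Lemma is_subfield_range (F : fieldType) (f : {rmorphism F -> L}) :
  is_subfield (range f).
Proof.
split; first by exists 1; rewrite ?rmorph1.
  by move=> _ _ [x _ <-] [y _ <-]; exists (x - y); rewrite ?rmorphB.
by move=> _ _ [x _ <-] [y _ <-]; exists (x / y); rewrite ?fmorph_div.
Qed.

Section Package.
Variable A : divringClosed L.
Definition subfield_type := {x : L | x \in A}.
HB.instance Definition _ := SubChoice.on subfield_type.
HB.instance Definition _ := [SubChoice_isSubIntegralDomain of subfield_type by <:].
HB.instance Definition _ := [SubIntegralDomain_isSubField of subfield_type by <:].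
End Package.

Lemma is_subfieldP (A : set L) : is_subfield A ->
  exists (F : fieldType) (f : {rmorphism F -> L}), range f = A.
Proof.
move=> [A1 AB Adiv].
have closedA : divring_closed (mem A).
  by split=> [|x y|x y]; rewrite !inE //; [apply: AB|apply: Adiv].
pose cA := GRing.isDivringClosed.Build L (mem A) closedA.
pose pA : divringClosed L := HB.pack (mem A : {pred L}) cA.
exists (subfield_type pA), (val : {rmorphism subfield_type pA -> L}).
apply/seteqP; split=> [_ [[x Ax] _ <-]|x Ax] /=; first by rewrite -in_setE.
have xA : x \in pA by rewrite in_setE.
by exists (exist _ x xA).
Qed.
End Subfields.

Section Adjunction.
Variables (F L : fieldType) (f : {rmorphism F -> L}).

Definition eval_at (x : L) : {poly F} -> L := horner_eval x \o map_poly f.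
HB.instance Definition _ x := GRing.RMorphism.on (eval_at x).

Definition adjoin (x : L) : set L :=
  [set z | exists p q, eval_at x q != 0 /\ z = eval_at x p / eval_at x q].

Lemma eval_atC x c : eval_at x c%:P = f c.
Proof. by rewrite /eval_at /= map_polyC horner_evalE hornerC. Qed.

Lemma eval_atX x : eval_at x 'X = x.
Proof. by rewrite /eval_at /= map_polyX horner_evalE hornerX. Qed.

Lemma eval_at_comp x p q : eval_at x (p \Po q) = eval_at (eval_at x q) p.
Proof. by rewrite /eval_at /= !horner_evalE map_comp_poly horner_comp. Qed.

Lemma eval_at_eq0 x p : ~ algebraicOver f x -> (eval_at x p == 0) = (p == 0).
Proof.
move=> tr_x; apply/idP/idP=> [p0|/eqP->]; last by rewrite rmorph0.
by apply: contra_notT tr_x => nz_p; exists p.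
Qed.

Lemma adjoin_poly x p : adjoin x (eval_at x p).
Proof. by exists p, 1; rewrite rmorph1 oner_eq0 divr1. Qed.

Lemma adjoin_is_subfield x : is_subfield (adjoin x).
Proof.
split; first by rewrite -[1](rmorph1 (eval_at x)); apply: adjoin_poly.
  move=> _ _ [p1 [q1 [nz1 ->]]] [p2 [q2 [nz2 ->]]].
  exists (p1 * q2 - p2 * q1), (q1 * q2).
  by rewrite rmorphB !rmorphM mulf_neq0 //; split=> //; field; apply/andP.
move=> _ _ [p1 [q1 [nz1 ->]]] [p2 [q2 [nz2 ->]]].
have [z|nz] := eqVneq (eval_at x p2) 0.
  exists 0, 1; rewrite rmorph0 rmorph1 oner_eq0 z; split=> //.
  by rewrite !(mul0r, invr0, mulr0).
exists (p1 * q2), (q1 * p2).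
by rewrite !rmorphM mulf_neq0 //; split=> //; field; apply/and3P.
Qed.

(** Clearing denominators turns coefficients in F(a) into coefficients in
    F[a], so algebraicity over F(a) is a statement about bivariate polynomials
    over F. *)
Lemma algebraic_adjoinP (G : fieldType) (g : {rmorphism G -> L}) a x :
  range g = adjoin a ->
  algebraicOver g x <->
  exists2 P, map_poly (eval_at a) P != 0 & root (map_poly (eval_at a) P) x.
Proof.
move=> gE; split=> [[p nz_p px0]|[P nzP Px0]].
  have /choice[N /choice[Q NQ]] i : exists n q, eval_at a q != 0 /\
      g p`_i = eval_at a n / eval_at a q.
    have : range g (g p`_i) by exists p`_i.
    by rewrite gE.
  pose P := \poly_(i < size p) (N i * \prod_(j < size p | j != i :> nat) Q j).
  have PE : map_poly (eval_at a) P =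
      eval_at a (\prod_(j < size p) Q j) *: map_poly g p.
    apply/polyP=> i; rewrite coef_map coefZ coef_map /= coef_poly.
    have [ltip|] := ltnP i (size p); last first.
      by move=> /leq_sizeP/(_ i (leqnn _))->; rewrite !rmorph0 mulr0.
    rewrite rmorphM (NQ i).2 [\prod_(j < size p) Q j](bigD1 (Ordinal ltip)) //=.
    rewrite rmorphM (eq_bigl (fun j : 'I__ => j != i :> nat)) //.
    set u := eval_at a (\prod_(_ < _ | _) _).
    by have := (NQ i).1; move=> ?; field.
  exists P; rewrite PE.
    rewrite scaler_eq0 map_poly_eq0 negb_or nz_p andbT rmorph_prod.
    by apply/prodf_neq0=> i _; exact: (NQ i).1.
  by rewrite rootE hornerZ (rootP px0) mulr0.
have /choice[c cE] i : exists c, g c = eval_at a P`_i.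
  have : adjoin a (eval_at a P`_i) by exact: adjoin_poly.
  by rewrite -gE => -[c _ <-]; exists c.
have PE : map_poly (eval_at a) P = map_poly g (\poly_(i < size P) c i).
  apply/polyP=> i; rewrite !coef_map /= coef_poly; have [//|] := ltnP.
  by move=> /leq_sizeP/(_ i (leqnn _))->; rewrite !rmorph0.
rewrite PE in nzP Px0; exists (\poly_(i < size P) c i) => //.
by rewrite map_poly_eq0 in nzP.
Qed.

(** The exchange property: a polynomial relation P(a, x) = 0 that involves x
    also involves a, since x satisfies no equation over F. *)
Lemma algebraic_exchange (G H : fieldType)
    (g : {rmorphism G -> L}) (h : {rmorphism H -> L}) a x :
  range g = adjoin a -> range h = adjoin x -> ~ algebraicOver f x ->
  algebraicOver g x -> algebraicOver h a.
Proof.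
move=> gE hE tr_x /(algebraic_adjoinP _ gE)[P nzP Px0].
apply/(algebraic_adjoinP _ hE); exists (swapXY P).
  have : swapXY P != 0.
    by rewrite swapXY_eq0; apply: contraNneq nzP => ->; rewrite rmorph0.
  rewrite -lead_coef_eq0; set Q := swapXY P => nzQ.
  apply/eqP=> /polyP/(_ (size Q).-1).
  rewrite coef_map coef0 => /eqP; rewrite /= eval_at_eq0 //.
  exact: (negP nzQ).
have evE (y z : L) (R : {poly {poly F}}) :
    (map_poly (eval_at y) R).[z] = (swapXY (map_poly (map_poly f) R)).[y%:P].[z].
  by rewrite horner_swapXY /eval_at map_poly_comp.
rewrite rootE evE swapXY_map swapXYK; move/rootP: Px0; rewrite evE.
by rewrite (horner2_swapXY _ a x) => ->.
Qed.
End Adjunction.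

Section MaximalSubfield.
Variable L : fieldType.
Implicit Types (A B : set L) (x : L).

Definition algebraic_over A x : Prop :=
  exists p : {poly L}, [/\ p != 0, forall i, A p`_i & root p x].

Lemma algebraic_overP (F : fieldType) (f : {rmorphism F -> L}) x :
  algebraic_over (range f) x <-> algebraicOver f x.
Proof.
split=> [[p [nzp pA px]]|[p nzp px]]; last first.
  exists (map_poly f p); rewrite map_poly_eq0; split=> // i.
  by rewrite coef_map; exists p`_i.
have /choice[c cE] i : exists c, f c = p`_i by have [c _ <-] := pA i; exists c.
have pE : p = map_poly f (\poly_(i < size p) c i).
  apply/polyP=> i; rewrite coef_map /= coef_poly.
  have [_|ip] := ltnP; first by rewrite cE.
  by rewrite nth_default // rmorph0.
rewrite pE in nzp px; exists (\poly_(i < size p) c i) => //.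
by rewrite map_poly_eq0 in nzp.
Qed.

Lemma chain_bigcup_seq (E : set (set L)) (s : seq L) B0 :
    E B0 -> total_on E subset ->
    {in s, forall z, (\bigcup_(B in E) B) z} ->
  exists2 B, E B & {in s, forall z, B z}.
Proof.
move=> EB0 totE; elim: s => [|z s IHs] sE; first by exists B0.
have [|B EB sB] := IHs; first by move=> y sy; apply: sE; rewrite inE sy orbT.
have [|B' EB' zB'] := sE z; first by rewrite inE eqxx.
have [le|le] := totE B B' EB EB'; [exists B' => //|exists B => //].
  by move=> y; rewrite inE => /predU1P[->//|/sB/le].
by move=> y; rewrite inE => /predU1P[->|/sB//]; apply: le.
Qed.

Lemma is_subfield_chain (E : set (set L)) B0 : E B0 -> total_on E subset ->
  (forall B, E B -> is_subfield B) -> is_subfield (\bigcup_(B in E) B).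
Proof.
move=> EB0 totE fE; have [B01 _ _] := fE _ EB0.
have two x y : (\bigcup_(B in E) B) x -> (\bigcup_(B in E) B) y ->
    exists2 B, E B & B x /\ B y.
  move=> Ex Ey; have [|B EB sB] := @chain_bigcup_seq _ [:: x; y] _ EB0 totE.
    by move=> z; rewrite !inE => /orP[] /eqP->.
  by exists B => //; split; apply: sB; rewrite !inE eqxx ?orbT.
split=> [|x y /two H /H[B EB [Bx By]]|x y /two H /H[B EB [Bx By]]].
- by exists B0.
- by exists B => //; have [_ BB _] := fE _ EB; apply: BB.
- by exists B => //; have [_ _ Bd] := fE _ EB; apply: Bd.
Qed.

(** By maximality of F among the subfields over which x is transcendental and
    by exchange, F and x exhaust L up to algebraic elements: {x} is a
    transcendence basis of L over F. *)
Lemma exists_transcendence_base A x : is_subfield A -> ~ algebraic_over A x ->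
  exists (F : fieldType) (f : {rmorphism F -> L}),
    [/\ A `<=` range f, ~ algebraicOver f x &
      forall (G : fieldType) (g : {rmorphism G -> L}), range g = adjoin f x ->
      forall a, algebraicOver g a].
Proof.
move=> fA tr_x.
pose good B := [/\ is_subfield B, A `<=` B & ~ algebraic_over B x].
(* the union of the empty chain is the empty set *)
have [|B [PB maxB]] := @Zorn_bigcup _ (fun B => B = set0 \/ good B).
  move=> E goodE totE.
  have [[B0 EB0 gB0]|noB] := pselect (exists2 B, E B & good B); last first.
    left; apply/seteqP; split=> // z [B EB Bz]; have [B0|gB] := goodE _ EB.
      by rewrite B0 in Bz.
    by case: noB; exists B.
  pose E' := [set B | E B /\ good B].
  have -> : \bigcup_(B in E) B = \bigcup_(B in E') B.
    apply/seteqP; split=> z [B EB Bz]; last by exists B => //; case: EB.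
    by exists B => //; split=> //; have [B0'|//] := goodE _ EB; rewrite B0' in Bz.
  have E'B0 : E' B0 by [].
  have totE' : total_on E' subset by move=> X Y [EX _] [EY _]; apply: totE.
  right; split.
  - by apply: (is_subfield_chain E'B0 totE') => X [_ []].
  - by move=> z Az; exists B0 => //; have [_ AB _] := gB0; apply: AB.
  - move=> [p [nzp pE px]].
    have [|B [_ [fB _ trB]] pB] := @chain_bigcup_seq E' (polyseq p) _ E'B0 totE'.
      by move=> z /(nthP 0)[i _ <-]; exact: pE.
    apply: trB; exists p; split=> // i.
    have [/(mem_nth 0)/pB//|/(nth_default 0)->] := ltnP i (size p).
    by have [B1 BB _] := fB; rewrite -(subrr 1); apply: BB.
have {PB}[fB AB trB] : good B.
  have [B0|//] := PB; exfalso; apply: (maxB A); last by right; split.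
  rewrite B0; split=> //; have [A1 _ _] := fA => sA; exact: (sA _ A1).
have [F [f fE]] := is_subfieldP fB.
exists F, f; rewrite fE; split=> //.
  by move/algebraic_overP; rewrite fE.
move=> G g gE a.
have [H [h hE]] := is_subfieldP (adjoin_is_subfield f a).
have [alg|tr] := pselect (algebraicOver h x).
  apply: (algebraic_exchange hE gE _ alg); by move/algebraic_overP; rewrite fE.
have sub : B `<=` range h.
  rewrite -fE hE => _ [c _ <-]; rewrite -(eval_atC f a); exact: adjoin_poly.
suff Ba : B a.
  rewrite -fE in Ba; case: Ba => c _ <-.
  have : adjoin f x (f c) by rewrite -(eval_atC f x); exact: adjoin_poly.
  by rewrite -gE => -[d _ <-]; exact: algebraic_id.
apply: contrapT => nBa; apply: (maxB (range h)); last first.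
  right; split; [exact: is_subfield_range|exact: subset_trans sub|].
  by move/algebraic_overP.
split=> // le; apply: nBa; apply: le; rewrite hE -{2}(eval_atX f a).
exact: adjoin_poly.
Qed.
End MaximalSubfield.

(** * Derivations and their algebraic extension *)

Definition derivation_along (K L : nzRingType) (f D : K -> L) : Prop :=
  (forall a b, D (a + b) = D a + D b) /\
  (forall a b, D (a * b) = D a * f b + f a * D b).

Section Basics.
Variables (K L : nzRingType) (f : {rmorphism K -> L}) (D : K -> L).
Hypothesis derD : derivation_along f D.

Lemma deriv_along0 : D 0 = 0.
Proof. by apply: (addrI (D 0)); rewrite -derD.1 !addr0. Qed.

Lemma deriv_along1 : D 1 = 0.
Proof.
apply: (addrI (D 1)); rewrite addr0 -{3}[1]mulr1 derD.2.
by rewrite rmorph1 mulr1 mul1r.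
Qed.

Lemma deriv_alongN a : D (- a) = - D a.
Proof. by apply: (addrI (D a)); rewrite -derD.1 !subrr deriv_along0. Qed.

Lemma deriv_alongB a b : D (a - b) = D a - D b.
Proof. by rewrite derD.1 deriv_alongN. Qed.

Lemma deriv_along_sum (I : Type) (r : seq I) (P : pred I) (F : I -> K) :
  D (\sum_(i <- r | P i) F i) = \sum_(i <- r | P i) D (F i).
Proof. exact: (big_morph D derD.1 deriv_along0). Qed.
End Basics.

(** This is d/dx on the rational functions F(x). It is well defined by the
    quotient rule, because a fraction in x determines its numerator and its
    denominator up to proportionality. *)
Lemma adjoin_derivation (F G L : fieldType)
    (f : {rmorphism F -> L}) (g : {rmorphism G -> L}) x :
  ~ algebraicOver f x -> range g = adjoin f x ->
  exists2 d : G -> G, derivation_along idfun d &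
    forall p b, g b = eval_at f x p -> g (d b) = eval_at f x p^`().
Proof.
move=> tr_x gE; pose ev : {rmorphism {poly F} -> L} := eval_at f x.
have ev_eq0 p : (ev p == 0) = (p == 0) by exact: eval_at_eq0.
have /choice[N /choice[Q NQ]] b : exists n q, ev q != 0 /\ g b = ev n / ev q.
  by have : range g (g b); [exists b|rewrite gE].
have /choice[d dE] b : exists c, g c =
    (ev (N b)^`() * ev (Q b) - ev (N b) * ev (Q b)^`()) / ev (Q b) ^+ 2.
  have : adjoin f x
      ((ev (N b)^`() * ev (Q b) - ev (N b) * ev (Q b)^`()) / ev (Q b) ^+ 2).
    exists ((N b)^`() * Q b - N b * (Q b)^`()), (Q b ^+ 2).
    by rewrite rmorphXn rmorphB !rmorphM expf_neq0 //; case: (NQ b).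
  by rewrite -gE => -[c _ <-]; exists c.
have key p q b : ev q != 0 -> g b = ev p / ev q ->
    g (d b) = (ev p^`() * ev q - ev p * ev q^`()) / ev q ^+ 2.
  move=> nzq gb; rewrite dE; have [nzQ gb'] := NQ b.
  have /eqP : ev (p * Q b - N b * q) = 0.
    rewrite rmorphB !rmorphM; apply/eqP; rewrite subr_eq0; apply/eqP.
    have /(congr1 (fun z => z * (ev q * ev (Q b)))) := etrans (esym gb) gb'.
    have -> : ev p / ev q * (ev q * ev (Q b)) = ev p * ev (Q b) by field.
    by have -> : ev (N b) / ev (Q b) * (ev q * ev (Q b)) = ev (N b) * ev q by field.
  rewrite ev_eq0 subr_eq0 => /eqP e0.
  have := congr1 (fun u => ev u^`()) e0; rewrite !derivM !rmorphD !rmorphM.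
  move/(congr1 ev): e0; rewrite !rmorphM => e0 e1.
  apply/eqP; rewrite eqr_div ?expf_neq0 // -subr_eq0; apply/eqP.
  move: e0 e1; move: (ev p) (ev q) (ev (N b)) (ev (Q b)) (ev p^`()) (ev q^`())
    (ev (N b)^`()) (ev (Q b)^`()) => p0 q0 n0 Q0 p1 q1 n1 Q1 e0 e1.
  transitivity ((q0 * Q1 + q1 * Q0) * (p0 * Q0 - n0 * q0)
    - q0 * Q0 * ((p1 * Q0 + p0 * Q1) - (n1 * q0 + n0 * q1))); first by ring.
  by rewrite e0 e1 !subrr !mulr0 subrr.
exists d => [|p b gb]; last first.
  rewrite (key p 1) ?rmorph1 ?oner_eq0 ?divr1 //.
  by rewrite derivC rmorph0 mulr0 mulr1 subr0 expr1n divr1.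
split=> a b; apply: (fmorph_inj g); have [nza ga] := NQ a; have [nzb gb] := NQ b.
  have nz : ev (Q a * Q b) != 0 by rewrite rmorphM mulf_neq0.
  have gab : g (a + b) = ev (N a * Q b + N b * Q a) / ev (Q a * Q b).
    by rewrite (rmorphD g) ga gb rmorphD !rmorphM; field; apply/andP.
  rewrite (key _ _ _ nz gab) (rmorphD g) !dE derivD !derivM !rmorphD !rmorphM.
  by field; apply/andP.
have nz : ev (Q a * Q b) != 0 by rewrite rmorphM mulf_neq0.
have gab : g (a * b) = ev (N a * N b) / ev (Q a * Q b).
  by rewrite (rmorphM g) ga gb !rmorphM; field; apply/andP.
rewrite (key _ _ _ nz gab) /= (rmorphD g) !(rmorphM g) !dE ga gb.
rewrite !derivM !rmorphD !rmorphM.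
by field; apply/andP.
Qed.

Section MinimalPolynomials.
Variables (K L : fieldType) (f : {rmorphism K -> L}).
Hypothesis charK0 : [pchar K] =i pred0.

Definition minimal_poly_of (m : {poly K}) (z : L) : Prop :=
  [/\ m != 0, eval_at f z m = 0 &
      forall p, eval_at f z p = 0 -> p != 0 -> (size m <= size p)%N].

Lemma minimal_poly_exists z : algebraicOver f z -> exists m, minimal_poly_of m z.
Proof.
case=> p nzp pz; pose P k := `[< exists q, [/\ q != 0, eval_at f z q = 0 & size q = k] >].
have exP : exists k, P k.
  by exists (size p); apply/asboolP; exists p; split=> //; apply/rootP.
case: (ex_minnP exP) => k /asboolP[m [nzm mz <-]] mink; exists m; split=> // q qz nzq.
by apply: mink; apply/asboolP; exists q.
Qed.

Variables (m : {poly K}) (z : L).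
Hypothesis mz : minimal_poly_of m z.

Lemma minimal_poly_dvd p : eval_at f z p = 0 -> m %| p.
Proof.
move=> pz; have [nzm m0 minm] := mz; rewrite /dvdp; apply: contraT => nzr.
have := minm (p %% m) _ nzr; rewrite leqNgt ltn_modp nzm; apply.
have := congr1 (eval_at f z) (divp_eq p m).
by rewrite pz rmorphD rmorphM /= m0 mulr0 add0r.
Qed.

Lemma minimal_poly_coprime p : eval_at f z p != 0 -> coprimep m p.
Proof.
move=> npz; have [nzm m0 minm] := mz; rewrite /coprimep.
have [/dvdpP[q mE] /dvdpP[r pE]] := (dvdp_gcdl m p, dvdp_gcdr m p).
have nzg : eval_at f z (gcdp m p) != 0.
  by apply: contraNneq npz => g0; rewrite pE rmorphM /= g0 mulr0.
have q0 : eval_at f z q = 0.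
  move/(congr1 (eval_at f z)): mE; rewrite m0 rmorphM /= => /esym/eqP.
  by rewrite mulf_eq0 (negPf nzg) orbF => /eqP.
have nzgq : (gcdp m p != 0) && (q != 0).
  by rewrite -negb_or; apply: contraNN nzm => /orP[]/eqP e; rewrite mE e ?(mulr0, mul0r).
have /andP[ng nq] := nzgq.
have := minm q q0 nq; rewrite {1}mE size_mul // -subn1 leq_subLR addnC leq_add2r.
by rewrite leq_eqVlt ltnS leqn0 size_poly_eq0 (negPf ng) orbF.
Qed.

Lemma minimal_poly_separable : eval_at f z m^`() != 0.
Proof.
have [nzm m0 minm] := mz.
have gt1 : (1 < size m)%N.
  rewrite ltnNge; apply: contra nzm => /size1_polyC mE.
  by move: m0; rewrite mE eval_atC => /eqP; rewrite fmorph_eq0 polyC_eq0.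
apply/eqP=> /minm; rewrite leqNgt lt_size_deriv // => H; suff /H : m^`() != 0 by [].
have [k sm] : exists k, size m = k.+2 by case: (size m) gt1 => [|[|k]] // _; exists k.
apply/eqP=> /polyP/(_ k)/eqP; rewrite coef_deriv coef0 -mulr_natr mulf_eq0.
have /pcharf0P-> := charK0; rewrite orbF.
by have := lead_coef_eq0 m; rewrite lead_coefE sm (negPf nzm) => ->.
Qed.
End MinimalPolynomials.

Section PrimitiveElement.
Variables (K L : fieldType) (f : {rmorphism K -> L}).
Hypothesis charK0 : [pchar K] =i pred0.

Lemma primitive_element_seq (s : seq L) : {in s, forall a, algebraicOver f a} ->
  exists2 z, algebraicOver f z & {in s, forall a, exists p, a = eval_at f z p}.
Proof.
elim: s => [|a s IHs] algs; first by exists 0 => //; exact: algebraic0.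
have [|z [r nzr rz] sE] := IHs; first by move=> b bs; apply: algs; rewrite inE bs orbT.
have [q nzq qa] := algs a (mem_head _ _).
have [k [[p1 e1] [p2 e2]]] := pchar0_PET nzr rz nzq qa charK0.
exists (a *+ k - z).
  apply: algebraic_sub; last by exists r.
  rewrite -mulr_natr -(rmorph_nat f).
  apply: algebraic_mul; last exact: algebraic_id.
  by exists q.
move=> b; rewrite inE => /predU1P[->|/sE[p ->]]; first by exists p2.
exists (p \Po p1).
by rewrite eval_at_comp [eval_at _ _ p1]e1.
Qed.
End PrimitiveElement.

Section DerivationExtension.
Variables (K L : fieldType) (f : {rmorphism K -> L}) (d : K -> K).
Hypothesis charK0 : [pchar K] =i pred0.
Hypothesis derd : derivation_along idfun d.

(** Applying d to the coefficients is a derivation of K[X] for which X is a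
    constant. *)
Definition coef_deriv_along (p : {poly K}) : {poly K} := map_poly d p.
Local Notation dp := coef_deriv_along.

Lemma coef_derivE p i : (dp p)`_i = d p`_i.
Proof. by rewrite coef_map_id0 // (deriv_along0 derd). Qed.

Lemma coef_derivD p q : dp (p + q) = dp p + dp q.
Proof. by apply/polyP=> i; rewrite !(coef_derivE, coefD) derd.1. Qed.

Lemma coef_derivM p q : dp (p * q) = dp p * q + p * dp q.
Proof.
apply/polyP=> i; rewrite !(coef_derivE, coefD) !coefM -big_split /=.
rewrite (deriv_along_sum derd); apply: eq_bigr => j _.
by rewrite derd.2 !coef_derivE.
Qed.

Lemma coef_derivC c : dp c%:P = (d c)%:P.
Proof.
apply/polyP=> i; rewrite coef_derivE !coefC; case: ifP => // _.
exact: deriv_along0 derd.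
Qed.

Lemma coef_derivX : dp 'X = 0.
Proof.
apply/polyP=> i; rewrite coef_derivE coefX coef0.
by case: eqP => _; rewrite (deriv_along0 derd, deriv_along1 derd).
Qed.

(** The value that D (p z) must have, for a derivation D extending d, if
    D z = w. *)
Definition deriv_at (z w : L) (p : {poly K}) : L :=
  eval_at f z (dp p) + eval_at f z p^`() * w.

Lemma deriv_atD z w p q : deriv_at z w (p + q) = deriv_at z w p + deriv_at z w q.
Proof. by rewrite /deriv_at coef_derivD derivD !rmorphD /=; ring. Qed.

Lemma deriv_atM z w p q :
  deriv_at z w (p * q) =
  deriv_at z w p * eval_at f z q + eval_at f z p * deriv_at z w q.
Proof.
by rewrite /deriv_at coef_derivM derivM !rmorphD !rmorphM /=; ring.
Qed.

Lemma deriv_atC z w c : deriv_at z w c%:P = f (d c).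
Proof. by rewrite /deriv_at coef_derivC derivC rmorph0 mul0r addr0 eval_atC. Qed.

Lemma deriv_at_comp z w p q :
  deriv_at z w (p \Po q) = deriv_at (eval_at f z q) (deriv_at z w q) p.
Proof.
elim/poly_ind: p => [|p c IHp]; first by rewrite comp_poly0 -polyC0 !deriv_atC.
rewrite comp_poly_MXaddC !deriv_atD !deriv_atM IHp !deriv_atC eval_atX.
rewrite /deriv_at coef_derivX derivX rmorph0 add0r rmorph1 mul1r.
by rewrite eval_at_comp.
Qed.

Lemma derivation_eval (D : L -> L) : derivation_along idfun D ->
  (forall c, D (f c) = f (d c)) ->
  forall z p, D (eval_at f z p) = deriv_at z (D z) p.
Proof.
move=> derD Df z; elim/poly_ind=> [|p c IHp].
  by rewrite rmorph0 (deriv_along0 derD) -polyC0 deriv_atC (deriv_along0 derd) rmorph0.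
rewrite rmorphD rmorphM /= eval_atX eval_atC derD.1 derD.2 IHp Df.
rewrite deriv_atD deriv_atM deriv_atC eval_atX.
by rewrite {3}/deriv_at coef_derivX derivX rmorph0 add0r rmorph1 mul1r.
Qed.

(** If m is the minimal polynomial of z, then D (m z) = 0 forces
    D z = - (dp m)(z) / m'(z). That this defines a derivation of L is checked
    in the subfield generated by two elements, which is generated by one. *)
Theorem derivation_extension : (forall a, algebraicOver f a) ->
  exists2 D : L -> L, derivation_along idfun D & forall c, D (f c) = f (d c).
Proof.
move=> algL.
have /choice[m mE] a : exists m, minimal_poly_of f m a.
  exact: minimal_poly_exists (algL a).
pose D a := - (eval_at f a (dp (m a)) / eval_at f a (m a)^`()).
have Dm a : deriv_at a (D a) (m a) = 0.
  by rewrite /deriv_at /D; have := minimal_poly_separable charK0 (mE a) => nz; field.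
have well_def z p q : eval_at f z p = eval_at f z q ->
    deriv_at z (D z) p = deriv_at z (D z) q.
  move=> pq; suff /eqP : deriv_at z (D z) (p - q) = 0.
    rewrite deriv_atD -[- q]mulN1r -polyC1 -polyCN deriv_atM deriv_atC eval_atC.
    rewrite (deriv_alongN derd) (deriv_along1 derd) oppr0 rmorph0 mul0r add0r.
    by rewrite rmorphN rmorph1 mulN1r subr_eq0 => /eqP.
  have /(minimal_poly_dvd (mE z))/dvdpP[r ->] : eval_at f z (p - q) = 0.
    by rewrite rmorphB /= pq subrr.
  by rewrite deriv_atM Dm; have [_ -> _] := mE z; rewrite !mulr0 addr0.
have Deval z p : D (eval_at f z p) = deriv_at z (D z) p.
  set a := eval_at f z p.
  have : deriv_at z (D z) (m a \Po p) = deriv_at z (D z) 0.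
    by apply: well_def; rewrite rmorph0 eval_at_comp; have [_ e _] := mE a.
  rewrite deriv_at_comp -polyC0 deriv_atC (deriv_along0 derd) rmorph0 -/a.
  rewrite {1}/deriv_at; have := minimal_poly_separable charK0 (mE a) => nz e.
  apply: (mulIf nz); rewrite /D mulNr divfK // mulrC.
  by apply/eqP; rewrite eq_sym -subr_eq0 opprK addrC e.
have pair a b : exists z p q, a = eval_at f z p /\ b = eval_at f z q.
  have [z _ zE] := @primitive_element_seq _ _ f charK0 [:: a; b] (fun c _ => algL c).
  have [p pE] := zE a (mem_head _ _).
  by have [|q qE] := zE b; [rewrite !inE eqxx orbT|exists z, p, q].
exists D => [|c]; last by rewrite -(eval_atC f 0) Deval deriv_atC.
split=> a b; have [z [p [q [-> ->]]]] := pair a b.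
  by rewrite -rmorphD /= !Deval deriv_atD.
by rewrite -rmorphM /= !Deval deriv_atM.
Qed.
End DerivationExtension.

(** * Logarithmic derivatives of norms, and residues *)

Lemma dlog_prod (L : fieldType) (D : L -> L) (I : eqType) (r : seq I) (F : I -> L) :
  derivation_along idfun D -> {in r, forall i, F i != 0} ->
  D (\prod_(i <- r) F i) / \prod_(i <- r) F i = \sum_(i <- r) D (F i) / F i.
Proof.
move=> derD; elim: r => [|i r IHr] nzF.
  by rewrite !big_nil (deriv_along1 derD) mul0r.
have nzFr : {in r, forall i, F i != 0} by move=> j jr; rewrite nzF // inE jr orbT.
have nzi := nzF i (mem_head _ _).
have nzp : \prod_(j <- r) F j != 0 by rewrite prodf_seq_neq0; apply/allP.
by rewrite !big_cons -IHr // derD.2 /=; field; apply/andP.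
Qed.

Section Norm.
Variables (K L : fieldType) (f : {rmorphism K -> L}).

(** The norm of p(z), for z a root of m: multiplication by p modulo m has its
    matrix M over K, and the Vandermonde matrix of the conjugates of z
    diagonalises M. *)
Lemma norm_in_base (m : {poly K}) (r : seq L) (p : {poly K}) :
  m != 0 -> uniq r -> size m = (size r).+1 ->
  {in r, forall y, eval_at f y m = 0} ->
  exists N, f N = \prod_(y <- r) eval_at f y p.
Proof.
move=> nzm uniq_r sm rm; pose n := size r.
pose M : 'M[K]_n := \matrix_(a, b) ((p * 'X^a) %% m)`_b.
pose y : 'rV[L]_n := \row_j r`_j.
pose V := Vandermonde n y.
have MV : map_mx f M *m V = V *m diag_mx (\row_j eval_at f (r`_j) p).
  apply/matrixP=> a j; rewrite mul_mx_diag !mxE.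
  have rj : r`_j \in r by rewrite mem_nth.
  have := congr1 (eval_at f r`_j) (divp_eq (p * 'X^a) m).
  rewrite !(rmorphM, rmorphD, rmorphXn) /= (rm _ rj) mulr0 add0r eval_atX mulrC => ->.
  rewrite /eval_at /= horner_evalE (@horner_coef_wide _ n); last first.
    by rewrite size_map_poly -ltnS -sm ltn_modp.
  by apply: eq_bigr => b _; rewrite coef_map !mxE.
exists (\det M); rewrite -det_map_mx.
have nzV : \det V != 0.
  rewrite det_Vandermonde; apply/prodf_neq0 => i _; apply/prodf_neq0 => j ij.
  by rewrite !mxE subr_eq0 nth_uniq // gtn_eqF.
apply: (mulIf nzV); rewrite -det_mulmx MV det_mulmx det_diag mulrC; congr (_ * _).
by rewrite (big_nth 0) big_mkord; apply: eq_bigr => i _; rewrite mxE.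
Qed.
End Norm.

Section Descent.
Variables (K : fieldType) (L : closedFieldType) (f : {rmorphism K -> L}).
Hypothesis charK0 : [pchar K] =i pred0.

Lemma minimal_poly_roots (m : {poly K}) z : minimal_poly_of f m z ->
  exists r : seq L, [/\ uniq r, size m = (size r).+1, z \in r
    & {in r, forall y, eval_at f y m = 0}].
Proof.
move=> mz; have [nzm mz0 _] := mz.
have [r rE] := closed_field_poly_normal (map_poly f m).
have lc : lead_coef (map_poly f m) != 0 by rewrite lead_coef_eq0 map_poly_eq0.
have rootE y : root (map_poly f m) y = (y \in r).
  by rewrite rE rootZ // root_prod_XsubC.
exists r; split.
- rewrite -separable_prod_XsubC -(eqp_separable (_ : map_poly f m %= _)).
    rewrite separable_map unlock.
    by rewrite (minimal_poly_coprime mz (minimal_poly_separable charK0 mz)).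
  by rewrite {1}rE eqp_scale.
- by rewrite -(size_map_poly f) rE size_scale // size_prod_XsubC.
- by rewrite -rootE; apply/rootP.
- by move=> y; rewrite -rootE => /rootP.
Qed.

(** By the primitive element theorem all quantities are polynomials in one z.
    Conjugating the relation between the u_i over K and adding up the
    conjugates replaces each u_i by its norm. *)
Theorem dlog_relation_norm (d : K -> K) (D : L -> L)
    (I : finType) (c : I -> K) (u : I -> L) (i0 : I) (a : K) :
  derivation_along idfun d -> derivation_along idfun D ->
  (forall b, D (f b) = f (d b)) -> (forall z, algebraicOver f z) ->
  (forall i, u i != 0) -> u i0 = f a ->
  \sum_i f (c i) * (D (u i) / u i) = 0 ->
  exists (N : I -> K) (k : nat),
    [/\ (0 < k)%N, forall i, N i != 0, N i0 = a ^+ k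
      & \sum_i c i * (d (N i) / N i) = 0].
Proof.
move=> derd derD Df algL nzu ua rel.
have [z algz zE] := primitive_element_seq charK0
  (s := codom u ++ codom (fun i => D (u i) / u i)) (fun b _ => algL b).
have /choice[p pE] i : exists p, u i = eval_at f z p.
  by apply: zE; rewrite mem_cat codom_f.
have /choice[q qE] i : exists q, D (u i) / u i = eval_at f z q.
  by apply: zE; rewrite mem_cat orbC (codom_f (fun i => D (u i) / u i)).
have [m mz] := minimal_poly_exists algz.
have [r [uniq_r sm zr rm]] := minimal_poly_roots mz.
have [nzm mz0 _] := mz.
have conj0 y g : y \in r -> eval_at f z g = 0 -> eval_at f y g = 0.
  move=> yr /(minimal_poly_dvd mz)/dvdpP[h ->].
  by rewrite rmorphM /= (rm _ yr) mulr0.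
have conjN0 y g : y \in r -> eval_at f z g != 0 -> eval_at f y g != 0.
  move=> yr /(minimal_poly_coprime mz); rewrite -(coprimep_map f) => /coprimep_root.
  by apply; apply/rootP; exact: rm.
have Deval := derivation_eval derd derD Df.
have Droot y : y \in r ->
    eval_at f y (coef_deriv_along d m) + eval_at f y m^`() * D y = 0.
  by move=> yr; rewrite -[LHS]Deval rm // (deriv_along0 derD).
have Dp y i : y \in r -> D (eval_at f y (p i)) = eval_at f y (q i) * eval_at f y (p i).
  move=> yr.
  (* g(w) = 0 states D (p i w) = q i w * p i w with D w eliminated, so it is a
     polynomial condition over K that passes from z to its conjugates *)
  pose g := (coef_deriv_along d (p i) - q i * p i) * m^`()
            - (p i)^`() * coef_deriv_along d m.
  have gE w : w \in r -> eval_at f w g = (D (eval_at f w (p i))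
      - eval_at f w (q i) * eval_at f w (p i)) * eval_at f w m^`().
    move=> wr; rewrite Deval /deriv_at /g !(rmorphB, rmorphM) /=.
    have /eqP := Droot w wr; rewrite addr_eq0 => /eqP->; ring.
  have := conj0 y g yr; rewrite !gE // -pE -qE divfK // subrr mul0r => /(_ erefl)/eqP.
  rewrite mulf_eq0 (negPf (conjN0 y _ yr (minimal_poly_separable charK0 mz))) orbF.
  by rewrite subr_eq0 => /eqP.
have /choice[N NE] i : exists N, f N = \prod_(y <- r) eval_at f y (p i).
  exact: norm_in_base nzm uniq_r sm rm.
have nzp i y : y \in r -> eval_at f y (p i) != 0.
  by move=> yr; apply: conjN0; rewrite // -pE.
have nzN i : N i != 0.
  rewrite -(fmorph_eq0 f) NE prodf_seq_neq0; apply/allP => y yr /=.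
  exact: nzp.
exists N, (size r); split=> //; first by case: (r) zr.
  apply: (fmorph_inj f); rewrite NE rmorphXn /= (eq_big_seq (fun=> f a)).
    by rewrite big_const_seq count_predT -Monoid.iteropE.
  move=> y yr; apply/eqP; rewrite -subr_eq0 -(eval_atC f y) -rmorphB; apply/eqP.
  by apply: conj0 => //; rewrite rmorphB /= -pE eval_atC ua subrr.
apply: (fmorph_inj f); rewrite rmorph0 rmorph_sum /=.
have dN i : f (d (N i) / N i) = \sum_(y <- r) eval_at f y (q i).
  rewrite fmorph_div -Df NE dlog_prod //; last by move=> y; exact: nzp.
  by apply: eq_big_seq => y yr; rewrite Dp // mulfK // nzp.
under eq_bigr do rewrite rmorphM dN mulr_sumr.
rewrite exchange_big big_seq big1 //= => y yr.
have : eval_at f y (\sum_i (c i)%:P * q i) = 0.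
  apply: conj0 => //; rewrite rmorph_sum -[RHS]rel; apply: eq_bigr => i _.
  by rewrite rmorphM /= eval_atC qE.
rewrite rmorph_sum => e; rewrite -[RHS]e; apply: eq_bigr => i _.
by rewrite rmorphM /= eval_atC.
Qed.
End Descent.

Section Residues.
Variables (F L : fieldType) (f : {rmorphism F -> L}) (x : L).
Hypothesis tr_x : ~ algebraicOver f x.

(** At X = 0 the logarithmic derivative of X ^ m * s, with s(0) <> 0, has the
    residue m. As x is transcendental, the relation is an identity of rational
    functions, whose residue at 0 vanishes. *)
Lemma residue_dlog (J : finType) (c : J -> F) (r : J -> {poly F}) :
  (forall j, r j != 0) ->
  \sum_j f (c j) * (eval_at f x (r j)^`() / eval_at f x (r j)) = 0 ->
  \sum_j c j * (mup 0 (r j))%:R = 0.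
Proof.
move=> nzr rel.
have /choice[s sE] j : exists s, ~~ root s 0 /\ r j = s * 'X ^+ mup 0 (r j).
  have [n [s]] := multiplicity_XsubC (r j) 0; rewrite nzr subr0 /= => s0 rE.
  exists s; split=> //; rewrite {2}rE mupMr // -['X]subr0 -polyC0 mup_XsubCX eqxx.
  by rewrite subr0.
have nzx : x != 0 by apply/eqP=> x0; apply: tr_x; rewrite x0; exact: algebraic0.
pose ev : {rmorphism {poly F} -> L} := eval_at f x.
have ev_eq0 p : (ev p == 0) = (p == 0) by exact: eval_at_eq0.
have evX : ev 'X = x by exact: eval_atX.
have nzs j : s j != 0 by apply: contraNneq (sE j).1 => ->; rewrite root0.
have termE j : x * (eval_at f x (r j)^`() / eval_at f x (r j)) =
    (mup 0 (r j))%:R + x * (ev (s j)^`() / ev (s j)).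
  rewrite -[eval_at f x (r j)]/(ev (r j)) -[eval_at f x (r j)^`()]/(ev (r j)^`()).
  have := (sE j).2; move: (mup _ _) => n ->.
  have nzsj : ev (s j) != 0 by rewrite ev_eq0.
  have nzxn : x ^+ n != 0 by rewrite expf_neq0.
  have xn : x * (x ^+ n.-1 *+ n) = x ^+ n * n%:R.
    by case: n {nzxn} => [|n]; rewrite ?mulr0n ?mulr0 // mulrnAr -exprS mulr_natr.
  have evXn : ev ('X^n) = x ^+ n by rewrite rmorphXn evX.
  have evdXn : ev ('X^n)^`() = x ^+ n.-1 *+ n by rewrite derivXn rmorphMn rmorphXn evX.
  rewrite derivM (rmorphD ev) !(rmorphM ev) evXn evdXn.
  rewrite [RHS](_ : _ = (x * ev (s j)^`() * x ^+ n + ev (s j) * (x ^+ n * n%:R))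
    / (ev (s j) * x ^+ n)); last by field; apply/andP.
  rewrite -xn; move: (x ^+ n.-1 *+ n) (x ^+ n) nzxn => y w nzw.
  by field; apply/andP.
(* T j / s j is X times the logarithmic derivative of r j; it is defined at 0 *)
pose T j := (mup 0 (r j))%:R * s j + 'X * (s j)^`().
have relT : \sum_j f (c j) * (ev (T j) / ev (s j)) = 0.
  rewrite -[RHS](mulr0 x) -[in RHS]rel mulr_sumr; apply: eq_bigr => j _.
  have nzsj : ev (s j) != 0 by rewrite ev_eq0.
  rewrite [RHS]mulrCA termE; congr (_ * _).
  by rewrite rmorphD !rmorphM rmorph_nat evX; field.
pose W := \sum_j (c j)%:P * (T j * \prod_(l | l != j) s l).
have W0 : W = 0.
  apply/eqP; rewrite -ev_eq0 -[X in _ == X](mulr0 (\prod_l ev (s l))) -[in X in _ == X]relT.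
  rewrite rmorph_sum mulr_sumr; apply/eqP/eq_bigr => j _.
  have nzsj : ev (s j) != 0 by rewrite ev_eq0.
  have evC : ev (c j)%:P = f (c j) by exact: eval_atC.
  rewrite !rmorphM evC rmorph_prod [in RHS](bigD1 j) //=.
  by move: (\prod_(_ | _) _) => P; field.
have : W.[0] = (\sum_j c j * (mup 0 (r j))%:R) * \prod_l (s l).[0].
  rewrite horner_sum mulr_suml; apply: eq_bigr => j _.
  have T0 : (T j).[0] = (mup 0 (r j))%:R * (s j).[0].
    by rewrite /T hornerD !hornerM hornerX mul0r addr0 -polyC_natr hornerC.
  rewrite !hornerM hornerC horner_prod T0 [in RHS](bigD1 j) //=; ring.
have nzP : \prod_l (s l).[0] != 0 by apply/prodf_neq0 => j _; exact: (sE j).1.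
by rewrite W0 horner0 => /esym/eqP; rewrite mulf_eq0 (negPf nzP) orbF => /eqP.
Qed.
End Residues.

(** This is the case v = 0 of Rosenlicht's lemma on relations
    sum c_i du_i / u_i + dv = 0. If x = u_i were transcendental
    over A, complete A to F with L algebraic over F(x), and let D extend d/dx.
    The relation for D descends to F(x) by taking norms, the norm of x being a
    positive power of x; residues at x = 0 then give a nontrivial integer relation
    among the c_i. *)
Theorem dlog_relation_algebraic (L : closedFieldType) (A : set L) (I : finType)
    (c u : I -> L) :
  [pchar L] =i pred0 -> is_subfield A -> (forall i, A (c i)) ->
  (forall n : I -> int, \sum_i c i * (n i)%:~R = 0 -> forall i, n i = 0) ->
  (forall i, u i != 0) ->
  (forall D : L -> L, derivation_along idfun D -> (forall a, A a -> D a = 0) ->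
     \sum_i c i * (D (u i) / u i) = 0) ->
  forall i, algebraic_over A (u i).
Proof.
move=> charL0 fA Ac indep nzu rel i0; apply: contrapT => tr_x.
have [F [f [Af tr_xf algG]]] := exists_transcendence_base fA tr_x.
move: tr_xf algG; set x := u i0 => tr_xf algG.
have [G [g gE]] := is_subfieldP (adjoin_is_subfield f x).
have charG0 : [pchar G] =i pred0.
  by move=> p; rewrite -(fmorph_pchar g) charL0.
have [d derd dE] := adjoin_derivation tr_xf gE.
have [D derD Dg] := derivation_extension charG0 derd (algG _ _ gE).
have polyG p : exists b, g b = eval_at f x p.
  have : adjoin f x (eval_at f x p) by exact: adjoin_poly.
  by rewrite -gE => -[b _ <-]; exists b.
have DA a : A a -> D a = 0.
  move=> /Af[b _ <-]; have [b' b'E] := polyG b%:P.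
  by rewrite -(eval_atC f x) -b'E Dg (dE _ _ b'E) derivC rmorph0.
have /choice[e eE] i : exists b, f b = c i by have [b _ <-] := Af _ (Ac i); exists b.
have /choice[e' e'E] i : exists b, g b = c i.
  by have [b bE] := polyG (e i)%:P; exists b; rewrite bE eval_atC.
have [a aE] : exists a, u i0 = g a.
  by have [a aE] := polyG 'X; exists a; rewrite aE eval_atX.
have relg : \sum_i g (e' i) * (D (u i) / u i) = 0.
  by rewrite -[RHS](rel D derD DA); apply: eq_bigr => i _; rewrite e'E.
have [N [k [k_gt0 nzN Na Nrel]]] :=
  dlog_relation_norm charG0 derd derD Dg (algG _ _ gE) nzu aE relg.
have /choice[p /choice[q pqE]] i : exists p q, eval_at f x q != 0 /\
    g (N i) = eval_at f x p / eval_at f x q.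
  by have : range g (g (N i)); [exists (N i)|rewrite gE].
have nzq i : q i != 0 by have := (pqE i).1; rewrite eval_at_eq0.
have nzp i : p i != 0.
  rewrite -(eval_at_eq0 _ tr_xf); have := nzN i; rewrite -(fmorph_eq0 g) (pqE i).2.
  by rewrite mulf_eq0 negb_or => /andP[].
pose T (r : {poly F}) := eval_at f x r^`() / eval_at f x r.
have dN i : g (d (N i) / N i) = T (p i) - T (q i).
  have [[bp bpE] [bq bqE]] := (polyG (p i), polyG (q i)).
  have nzbp : bp != 0 by rewrite -(fmorph_eq0 g) bpE eval_at_eq0.
  have nzbq : bq != 0 by rewrite -(fmorph_eq0 g) bqE eval_at_eq0.
  have Nb : bp = N i * bq.
    apply: (fmorph_inj g); rewrite rmorphM /= (pqE i).2 bpE bqE divfK //.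
    by rewrite eval_at_eq0.
  rewrite /T -(dE _ _ bpE) -(dE _ _ bqE) -bpE -bqE -!fmorph_div -rmorphB.
  congr (g _); rewrite Nb derd.2 /=; have := nzN i => ?.
  by field; apply/andP.
(* numerators and denominators together, the latter with opposite coefficients *)
pose r (j : I + I) := match j with inl i => p i | inr i => q i end.
pose cr (j : I + I) := match j with inl i => e i | inr i => - e i end.
have res : \sum_j cr j * (mup 0 (r j))%:R = 0.
  apply: (residue_dlog tr_xf); first by case.
  rewrite big_sumType /= -big_split /= -[RHS](rmorph0 g) -[in RHS]Nrel rmorph_sum.
  apply: eq_bigr => i _; rewrite rmorphM /= dN e'E eE rmorphN eE mulNr -mulrBr //.
have := indep (fun i => (mup 0 (p i))%:Z - (mup 0 (q i))%:Z) _ i0.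
have -> : \sum_i c i * ((mup 0 (p i))%:Z - (mup 0 (q i))%:Z)%:~R = 0.
  rewrite -[RHS](rmorph0 f) -[in RHS]res big_sumType /= -big_split rmorph_sum /=.
  apply: eq_bigr => i _.
  by rewrite (rmorphD f) !(rmorphM f) rmorphN !(rmorph_nat f) eE intrB -!pmulrn; ring.
have pq0 : p i0 = 'X ^+ k * q i0.
  apply/eqP; rewrite -subr_eq0 -(eval_at_eq0 _ tr_xf).
  rewrite rmorphB rmorphM rmorphXn /= eval_atX.
  have := congr1 g Na; rewrite rmorphXn /= -aE (pqE i0).2 -/x => <-.
  by rewrite divfK ?subrr //; exact: (pqE i0).1.
move=> /(_ erefl)/eqP; rewrite pq0 mupM //; last by rewrite expf_neq0 // polyX_eq0.
rewrite -['X]subr0 -polyC0 mup_XsubCX eqxx PoszD addrK.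
by rewrite eqz_nat; case: k k_gt0 {Na pq0}.
Qed.

(** * Countability and continuity *)

(** Every element of the subfield generated by the c_i is the value of a finite
    expression, encoded as a tree whose nodes 0 and 1 stand for subtraction and
    division; an algebraic element is the j-th root of a polynomial with such
    coefficients. *)
Lemma countable_algebraic_closure (L : closedFieldType) (I : countType) (c : I -> L) :
  exists A : set L, [/\ is_subfield A, forall i, A (c i)
    & countable [set x | algebraic_over A x]].
Proof.
pose ev := fix ev (t : GenTree.tree I) : L := match t with
  | GenTree.Leaf i => c i
  | GenTree.Node 0 [:: a; b] => ev a - ev b
  | GenTree.Node 1 [:: a; b] => ev a / ev b
  | GenTree.Node _ _ => 1
  end.
exists (range ev); split.
- split; first by exists (GenTree.Node 2 [::]).
    by move=> _ _ [a _ <-] [b _ <-]; exists (GenTree.Node 0 [:: a; b]).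
  by move=> _ _ [a _ <-] [b _ <-]; exists (GenTree.Node 1 [:: a; b]).
- by move=> i; exists (GenTree.Leaf i).
pose root_of (sj : seq (GenTree.tree I) * nat) :=
  (sval (closed_field_poly_normal (Poly (map ev sj.1))))`_sj.2.
apply: sub_countable (countableP [set: seq (GenTree.tree I) * nat]).
apply: card_le_trans (card_image_le root_of _).
apply: subset_card_le => x [p [nzp pA px]].
have /choice[t tE] i : exists t, ev t = p`_i by have [t _ <-] := pA i; exists t.
pose s := mkseq t (size p).
have sE : Poly (map ev s) = p.
  apply/polyP=> i; rewrite coef_Poly -map_comp; have [ip|ip] := ltnP i (size p).
    by rewrite (nth_map 0%N) ?size_iota // nth_iota //= add0n tE.
  by rewrite !nth_default // size_map size_iota.
exists (s, index x (sval (closed_field_poly_normal p))) => //.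
rewrite /root_of /= sE; case: closed_field_poly_normal => r /= rE.
rewrite nth_index //; move: px; rewrite rE rootZ ?lead_coef_eq0 //.
by rewrite root_prod_XsubC.
Qed.

(** By the intermediate value theorem the image of a non-constant continuous
    function contains an interval of positive measure. *)
Lemma continuous_countable_image_const (R : realType) (f : R -> R) (a b : R) :
  {within `[a, b], continuous f} -> countable (f @` `[a, b]) ->
  forall t, a <= t <= b -> f t = f a.
Proof.
move=> cf ctf t /andP[at_ tb]; apply/eqP; apply: contraT => neq.
have sub : `[a, t] `<=` `[a, b].
  by move=> y /=; rewrite !in_itv /= => /andP[-> yt]; exact: le_trans tb.
have cft := continuous_subspaceW sub cf.
pose u := Num.min (f a) (f t); pose v := Num.max (f a) (f t).
have uv : u < v by rewrite /u /v; case: (ltgtP (f a) (f t)) neq => //= ->; rewrite eqxx.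
have img : `[u, v] `<=` f @` `[a, b].
  move=> y; rewrite /= in_itv /= => yuv.
  have [c ca <-] := IVT at_ cft yuv; exists c => //; exact: sub.
have := countable_lebesgue_measure0 (sub_countable (subset_card_le img) ctf).
rewrite lebesgue_measure_itv /= lte_fin uv -EFinD => -[] /eqP.
by rewrite subr_eq0 gt_eqF.
Qed.

(** * Vectors in three-dimensional space *)

Section SpaceVectors.
Variable F : fieldType.
Implicit Types (u v w a b d : 'rV[F]_3).

Definition dot u v : F := \sum_(i < 3) u 0 i * v 0 i.

Definition cross u v : 'rV[F]_3 :=
  let x (w : 'rV[F]_3) k := w 0 (inord k) in
  \row_(i < 3) [:: x u 1 * x v 2 - x u 2 * x v 1;
                   x u 2 * x v 0 - x u 0 * x v 2;
                   x u 0 * x v 1 - x u 1 * x v 0]`_i.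

Let i0 : 'I_3 := inord 0.
Let i1 : 'I_3 := inord 1.
Let i2 : 'I_3 := inord 2.

Let ord3 (i : 'I_3) : [\/ i = i0, i = i1 | i = i2].
Proof.
case: i => [[|[|[|//]]]] lti; [constructor 1|constructor 2|constructor 3];
by apply: val_inj; rewrite /= inordK.
Qed.

Let dotE u v : dot u v = u 0 i0 * v 0 i0 + u 0 i1 * v 0 i1 + u 0 i2 * v 0 i2.
Proof.
rewrite /dot !big_ord_recr big_ord0 /= add0r.
by congr (_ * _ + _ * _ + _ * _); congr (_ _ _); apply: val_inj; rewrite /= inordK.
Qed.

Let cross0 u v : cross u v 0 i0 = u 0 i1 * v 0 i2 - u 0 i2 * v 0 i1.
Proof. by rewrite mxE inordK. Qed.
Let cross1 u v : cross u v 0 i1 = u 0 i2 * v 0 i0 - u 0 i0 * v 0 i2.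
Proof. by rewrite mxE inordK. Qed.
Let cross2 u v : cross u v 0 i2 = u 0 i0 * v 0 i1 - u 0 i1 * v 0 i0.
Proof. by rewrite mxE inordK. Qed.

Let vecP u v :
  u 0 i0 = v 0 i0 -> u 0 i1 = v 0 i1 -> u 0 i2 = v 0 i2 -> u = v.
Proof. by move=> e0 e1 e2; apply/rowP => i; have [->|->|->] := ord3 i. Qed.

Let entryD u v i : (u + v) 0 i = u 0 i + v 0 i. Proof. exact: mxE. Qed.
Let entryN u i : (- u) 0 i = - u 0 i. Proof. exact: mxE. Qed.
Let entryZ (k : F) u i : (k *: u) 0 i = k * u 0 i. Proof. exact: mxE. Qed.
Let coordE := (dotE, cross0, cross1, cross2, entryD, entryN, entryZ).

Local Ltac coord_ring := rewrite ?coordE; ring.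
Local Ltac vec_ring := apply: vecP; coord_ring.

Lemma dotC u v : dot u v = dot v u. Proof. coord_ring. Qed.
Lemma dotDl u v w : dot (u + v) w = dot u w + dot v w. Proof. coord_ring. Qed.
Lemma dotBl u v w : dot (u - v) w = dot u w - dot v w. Proof. coord_ring. Qed.
Lemma dotBr u v w : dot u (v - w) = dot u v - dot u w. Proof. coord_ring. Qed.
Lemma dotZl k u v : dot (k *: u) v = k * dot u v. Proof. coord_ring. Qed.
Lemma dotNr u v : dot u (- v) = - dot u v. Proof. coord_ring. Qed.
Lemma dotDr u v w : dot u (v + w) = dot u v + dot u w. Proof. coord_ring. Qed.
Lemma dotZr k u v : dot u (k *: v) = k * dot u v. Proof. coord_ring. Qed.
Lemma dot0r u : dot u 0 = 0.
Proof. by rewrite -(scale0r 0) dotZr mul0r. Qed.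

Lemma dot_sumr u (I : Type) (r : seq I) (G : I -> 'rV[F]_3) :
  dot u (\sum_(i <- r) G i) = \sum_(i <- r) dot u (G i).
Proof. exact: (big_morph (dot u) (dotDr u) (dot0r u)). Qed.

Lemma crossvv u : cross u u = 0.
Proof. by apply: vecP; rewrite ?coordE mxE; ring. Qed.

Lemma cross0r u : cross u 0 = 0.
Proof. by apply: vecP; rewrite ?coordE !mxE; ring. Qed.

Lemma crossBl u v w : cross (u - v) w = cross u w - cross v w.
Proof. vec_ring. Qed.

Lemma crossBr u v w : cross u (v - w) = cross u v - cross u w.
Proof. vec_ring. Qed.

Lemma crossC u v : cross u v = - cross v u.
Proof. vec_ring. Qed.

Lemma cross_rot a b d : cross (d - b) (a - b) = cross (b - a) (d - a).
Proof. vec_ring. Qed.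

Lemma cross_comb (k l m p : F) u v :
  cross (k *: u + l *: v) (m *: u + p *: v) = (k * p - l * m) *: cross u v.
Proof. vec_ring. Qed.

Lemma dot_cross_cross u v w :
  dot (cross u v) (cross u w) = dot u u * dot v w - dot u v * dot u w.
Proof. coord_ring. Qed.

Lemma dot_crossC a b d : dot (cross d b) a = - dot (cross d a) b.
Proof. coord_ring. Qed.

Lemma dot_crossl u v : dot u (cross u v) = 0.
Proof. coord_ring. Qed.

Lemma dot_crossr u v : dot v (cross u v) = 0.
Proof. coord_ring. Qed.

Lemma cross_crossr u v : cross v (cross u v) = dot v v *: u - dot u v *: v.
Proof. vec_ring. Qed.

Lemma cross_crossl u v : cross u (cross u v) = dot u v *: u - dot u u *: v.
Proof. vec_ring. Qed.

Lemma frame_expansion a b v :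
  dot (cross a b) (cross a b) *: v =
  dot v (cross b (cross a b)) *: a - dot v (cross a (cross a b)) *: b
  + dot v (cross a b) *: cross a b.
Proof. vec_ring. Qed.

Lemma frame_eq0 a b v : dot (cross a b) (cross a b) != 0 ->
  dot v a = 0 -> dot v b = 0 -> dot v (cross a b) = 0 -> v = 0.
Proof.
move=> nz va vb vn; apply: (scalerI nz); rewrite scaler0 frame_expansion vn scale0r addr0.
rewrite cross_crossr cross_crossl !dotBr !dotZr va vb.
by rewrite !mulr0 subr0 !scale0r subr0.
Qed.

(** Lagrange's identity |u|^2 |v|^2 = (u . v)^2 + |u x v|^2 for the normals
    u = d x a and v = d x b, for which u x v = ((d x a) . b) d. *)
Lemma hinge_norm d a b :
  dot (cross d a) (cross d b) ^+ 2 + dot d d * dot (cross d a) b ^+ 2 =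
  dot (cross d a) (cross d a) * dot (cross d b) (cross d b).
Proof. coord_ring. Qed.

(** The hypotheses say that the Gram matrix of a and b is stationary. The
    components of w in the frame a, b, a x b can be read off from the components
    of a' and b' along a x b, and from a' . b. *)
Lemma angular_velocity_exists a b a' b' : dot (cross a b) (cross a b) != 0 ->
  dot a a' = 0 -> dot b b' = 0 -> dot a' b + dot a b' = 0 ->
  exists w, a' = cross w a /\ b' = cross w b.
Proof.
set n := cross a b => nz aa bb ab.
have ab' : dot a b' = - dot a' b by apply/eqP; rewrite -addr_eq0 addrC ab.
exists ((dot n n)^-1 *: (dot b' n *: a - dot a' n *: b + dot a' b *: n)).
have crossZl k u v : cross (k *: u) v = k *: cross u v by vec_ring.
rewrite !crossZl; split; apply: (scalerI nz); rewrite scalerA divff // scale1r.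
  rewrite [LHS]frame_expansion -/n cross_crossr cross_crossl !dotBr !dotZr.
  rewrite ![dot a' a]dotC aa mulr0 sub0r.
  have -> : cross (dot b' n *: a - dot a' n *: b + dot a' b *: n) a =
     dot a' n *: n + dot a' b *: (dot a a *: b - dot a b *: a).
    by rewrite /n; vec_ring.
  by vec_ring.
rewrite [LHS]frame_expansion -/n cross_crossr cross_crossl !dotBr !dotZr.
rewrite ![dot b' b]dotC bb ![dot b' a]dotC ab' mulr0.
have -> : cross (dot b' n *: a - dot a' n *: b + dot a' b *: n) b =
   dot b' n *: n + dot a' b *: (dot a b *: b - dot b b *: a).
  by rewrite /n; vec_ring.
by vec_ring.
Qed.

Definition proper_rotation (phi : 'rV[F]_3 -> 'rV[F]_3) : Prop :=
  [/\ forall k u v, phi (k *: u + v) = k *: phi u + phi v,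
      forall u v, dot (phi u) (phi v) = dot u v
    & forall u v, phi (cross u v) = cross (phi u) (phi v)].

Let dot_frame (k1 k2 k3 m1 m2 m3 : F) d a :
  dot (k1 *: d + k2 *: a + k3 *: cross d a) (m1 *: d + m2 *: a + m3 *: cross d a) =
  k1 * m1 * dot d d + (k1 * m2 + k2 * m1) * dot d a + k2 * m2 * dot a a
  + k3 * m3 * (dot d d * dot a a - dot d a * dot d a).
Proof. coord_ring. Qed.

Let cross_frame (k1 k2 k3 m1 m2 m3 : F) d a :
  cross (k1 *: d + k2 *: a + k3 *: cross d a) (m1 *: d + m2 *: a + m3 *: cross d a) =
  (k1 * m2 - k2 * m1) *: cross d a
  + (k1 * m3 - k3 * m1) *: (dot d a *: d - dot d d *: a)
  + (k2 * m3 - k3 * m2) *: (dot a a *: d - dot d a *: a).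
Proof. vec_ring. Qed.

(** Two vectors and their cross product form a frame whose Gram matrix and
    multiplication table for the cross product only depend on the inner products
    of the two vectors. *)
Lemma proper_rotation_exists d a d' a' : dot (cross d a) (cross d a) != 0 ->
  dot d d = dot d' d' -> dot d a = dot d' a' -> dot a a = dot a' a' ->
  exists2 phi, proper_rotation phi & phi d = d' /\ phi a = a'.
Proof.
set n := cross d a => nz dd da aa; pose n' := cross d' a'.
pose k1 u := (dot n n)^-1 * dot u (cross a n).
pose k2 u := - ((dot n n)^-1 * dot u (cross d n)).
pose k3 u := (dot n n)^-1 * dot u n.
have uE u : u = k1 u *: d + k2 u *: a + k3 u *: n.
  apply: (scalerI nz); rewrite [LHS]frame_expansion -/n !scalerDr !scalerA.
  by rewrite /k2 mulrN !(mulrA (dot n n)) divff // !mul1r scaleNr.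
pose phi u := k1 u *: d' + k2 u *: a' + k3 u *: n'.
have phi_lin k u v : phi (k *: u + v) = k *: phi u + phi v.
  rewrite /phi /k1 /k2 /k3 !dotDl !dotZl; move: (dot n n)^-1 => N.
  by rewrite /n /n'; vec_ring.
have phi0 : phi 0 = 0.
  by have := phi_lin (-1) 0 0; rewrite scaler0 addr0 scaleN1r addNr.
have phiZ k u : phi (k *: u) = k *: phi u by rewrite -[k *: u]addr0 phi_lin phi0 addr0.
have phiD u v : phi (u + v) = phi u + phi v by rewrite -[u]scale1r phi_lin !scale1r.
have phid : phi d = d'.
  have e1 : dot d (cross a n) = dot n n by rewrite /n; coord_ring.
  rewrite /phi /k1 /k2 /k3 e1 /n !dot_crossl !mulr0 oppr0 !scale0r !addr0.
  by rewrite mulVf // scale1r.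
have phia : phi a = a'.
  have e1 : dot a (cross d n) = - dot n n by rewrite /n; coord_ring.
  rewrite /phi /k1 /k2 /k3 e1 dot_crossl {3}/n dot_crossr !mulr0 !scale0r add0r addr0.
  by rewrite mulrN opprK mulVf // scale1r.
have phin : phi n = n'.
  have e1 : dot n (cross a n) = 0 by exact: dot_crossr.
  have e2 : dot n (cross d n) = 0 by exact: dot_crossr.
  by rewrite /phi /k1 /k2 /k3 e1 e2 !mulr0 oppr0 !scale0r !add0r mulVf // scale1r.
exists phi => //; split=> // u v.
  transitivity (dot (k1 u *: d + k2 u *: a + k3 u *: n)
                    (k1 v *: d + k2 v *: a + k3 v *: n)).
    by rewrite !dot_frame dd da aa.
  by rewrite -!uE.
have -> : cross (phi u) (phi v) =
    (k1 u * k2 v - k2 u * k1 v) *: n'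
    + (k1 u * k3 v - k3 u * k1 v) *: (dot d' a' *: d' - dot d' d' *: a')
    + (k2 u * k3 v - k3 u * k2 v) *: (dot a' a' *: d' - dot d' a' *: a').
  exact: cross_frame.
have -> : cross u v =
    (k1 u * k2 v - k2 u * k1 v) *: n
    + (k1 u * k3 v - k3 u * k1 v) *: (dot d a *: d - dot d d *: a)
    + (k2 u * k3 v - k3 u * k2 v) *: (dot a a *: d - dot d a *: a).
  by rewrite -cross_frame -!uE.
have phiB x y : phi (x - y) = phi x - phi y by rewrite -!scaleN1r phiD phiZ.
by rewrite !(phiB, phiD, phiZ) phid phia phin dd da aa.
Qed.

Lemma proper_rotationD phi u v : proper_rotation phi -> phi (u + v) = phi u + phi v.
Proof. by case=> lin _ _; rewrite -[u]scale1r lin !scale1r. Qed.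

Lemma proper_rotationB phi u v : proper_rotation phi -> phi (u - v) = phi u - phi v.
Proof.
by move=> rot; apply: (addIr (phi v)); rewrite -proper_rotationD // !subrK.
Qed.

Lemma proper_rotationZ phi k u : proper_rotation phi -> phi (k *: u) = k *: phi u.
Proof.
move=> rot; have [lin _ _] := rot; apply: (addIr (phi 0)).
by rewrite -lin addr0 -proper_rotationD // addr0.
Qed.

(** The hypotheses determine the inner products of b' with d, a and d x a: the
    second one is (d x a) . (d x b') up to a multiple of d . b' and the nonzero
    factor d . d. *)
Lemma proper_rotation_hinge (phi : 'rV[F]_3 -> 'rV[F]_3) d a b b' : proper_rotation phi ->
  dot d d != 0 -> dot (cross d a) (cross d a) != 0 ->
  dot (phi d) b' = dot d b ->
  dot (cross (phi d) (phi a)) (cross (phi d) b') = dot (cross d a) (cross d b) ->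
  dot (cross (phi d) (phi a)) b' = dot (cross d a) b ->
  b' = phi b.
Proof.
move=> [_ iso cr] nzd nz db cE sE; apply/eqP; rewrite -subr_eq0; apply/eqP.
apply: (@frame_eq0 (phi d) (phi a)); first by rewrite -cr iso.
- by rewrite dotBl iso [dot b' _]dotC db [dot b d]dotC subrr.
- apply: (mulfI nzd); rewrite mulr0 dotBl iso.
  move: cE; rewrite !dot_cross_cross !iso db => /addIr.
  by rewrite (dotC b') (dotC b) mulrBr => ->; rewrite subrr.
- by rewrite dotBl [dot b' _]dotC sE -cr iso [dot b _]dotC subrr.
Qed.

Section Derivation.
Variable D : F -> F.
Hypothesis derD : derivation_along idfun D.

Lemma deriv_dot u v : D (dot u v) = dot (map_mx D u) v + dot u (map_mx D v).
Proof.
rewrite /dot (deriv_along_sum derD) -big_split; apply: eq_bigr => i _.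
by rewrite derD.2 !mxE.
Qed.

Lemma deriv_cross u v :
  map_mx D (cross u v) = cross (map_mx D u) v + cross u (map_mx D v).
Proof.
have DB := deriv_alongB derD.
by apply: vecP; rewrite [LHS]mxE ?coordE DB !derD.2 /= !(mxE, inordK) //=; ring.
Qed.

(** The faces spanned by d, a and by d, b rotate with angular velocities w1 and
    w2. As both move d in the same way, w1 - w2 is parallel to d, and its
    component along the edge is, up to sign, the rate of change of the dihedral
    angle. The complex number U has this angle as its argument and the product of
    the doubled areas of the faces as its constant modulus. *)
Lemma deriv_hinge (d a b w1 w2 : 'rV[F]_3) (l im : F) :
  map_mx D d = cross w1 d -> map_mx D d = cross w2 d ->
  map_mx D a = cross w1 a -> map_mx D b = cross w2 b ->
  im ^+ 2 = -1 -> D im = 0 -> l ^+ 2 = dot d d -> D l = 0 ->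
  let U := dot (cross d a) (cross d b) + im * l * dot (cross d a) b in
  l * D U = - im * dot (w1 - w2) d * U.
Proof.
move=> dd1 dd2 da db im2 Dim l2 Dl U; set s := dot (cross d a) b in U *.
set c := dot (cross d a) (cross d b) in U *.
have wd : cross (w1 - w2) d = 0 by rewrite crossBl -dd1 -dd2 subrr.
have Dc : D c = dot (w1 - w2) d * s.
  rewrite /c deriv_dot !deriv_cross da db dd2.
  transitivity (dot d a * dot (cross (w1 - w2) d) b + dot (w1 - w2) d * s).
    by rewrite /s; coord_ring.
  by rewrite wd (dotC 0) dot0r mulr0 add0r.
have Ds : dot d d * D s = - dot (w1 - w2) d * c.
  rewrite /s deriv_dot !deriv_cross da db dd2.
  transitivity (dot d a * dot (cross d (cross (w1 - w2) d)) b - dot (w1 - w2) d * c).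
    by rewrite /c; coord_ring.
  by rewrite wd cross0r (dotC 0) dot0r mulr0 sub0r mulNr.
rewrite /U derD.1 2!derD.2 /= Dim Dl mul0r mulr0 addr0 mul0r add0r Dc.
rewrite [l * (_ + _)]mulrDr [X in _ + X](_ : _ = im * (l ^+ 2 * D s)); last by ring.
rewrite l2 Ds.
transitivity (- im * dot (w1 - w2) d * c + - im ^+ 2 * dot (w1 - w2) d * l * s).
  by rewrite im2; ring.
by ring.
Qed.

Lemma map_mx_derivB u v : map_mx D (u - v) = map_mx D u - map_mx D v.
Proof. by apply/rowP => i; rewrite !mxE (deriv_alongB derD). Qed.
End Derivation.
End SpaceVectors.

Section MapVectors.
Variables (F G : fieldType) (f : {rmorphism F -> G}).

Lemma dot_map_mx (x y : 'rV[F]_3) : dot (map_mx f x) (map_mx f y) = f (dot x y).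
Proof. by rewrite rmorph_sum; apply: eq_bigr => i _; rewrite !mxE rmorphM. Qed.

Lemma cross_map_mx (x y : 'rV[F]_3) :
  cross (map_mx f x) (map_mx f y) = map_mx f (cross x y).
Proof.
by apply/rowP => -[[|[|[|//]]] i]; rewrite !mxE /= rmorphB !rmorphM.
Qed.
End MapVectors.

(** * Hinges of an oriented complex *)

Section OrientedComplex.
Variables (R : realType) (n : nat) (K : {fset {fset 'rV[R]_n}}).
Variable o : {fset 'rV[R]_n} -> seq 'rV[R]_n.
Hypotheses (hK : strongly_connected_2complex K) (ho : consistent_orientation K o).
Implicit Types (x y z w : 'rV[R]_n) (e f g h : {fset 'rV[R]_n}).

Lemma simplices_sub i e : e \in simplices K i -> e \in K.
Proof. by rewrite in_fset => /andP[]. Qed.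

Lemma simplices_card i e : e \in simplices K i -> #|` e|%fset = i.+1.
Proof. by rewrite in_fset => /andP[_ /eqP]. Qed.

Lemma fset_perm e (s : seq 'rV[R]_n) : uniq s -> e =i s -> perm_eq (enum_fset e) s.
Proof. by move=> us es; exact: uniq_perm (fset_uniq e) us es. Qed.

Lemma face_next f x : f \in simplices K 2 -> x \in f -> exists y z,
  [/\ uniq [:: x; y; z], f =i [:: x; y; z], next (o f) x = y, next (o f) y = z
    & next (o f) z = x].
Proof.
move=> fK xf; have [uo of_] := orientation_vertices ho fK.
have perm_o : perm_eq (o f) (enum_fset f)
  by exact: uniq_perm uo (fset_uniq f) of_.
have so : size (o f) = 3%N by rewrite (perm_size perm_o) -(simplices_card fK).
have xo : x \in o f by rewrite of_.
have [i s rE] := rot_to xo; have us : uniq (x :: s) by rewrite -rE rot_uniq.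
have : size (x :: s) = 3%N by rewrite -rE size_rot.
case: s rE us => [|y [|z [|]]] // rE us _; exists y, z.
have nE v : next (o f) v = next [:: x; y; z] v by rewrite -rE next_rot.
have fE : f =i [:: x; y; z] by move=> v; rewrite -of_ -rE mem_rot.
have /and3P[/andP[xy xz] yz _] : [&& (x != y) && (x != z), y != z & true].
  by move: us; rewrite /= !inE !negb_or.
split; [exact: us|exact: fE| | |];
by rewrite nE /= ?(eq_sym y x) ?(eq_sym z) ?(negPf xy) ?(negPf xz) ?(negPf yz) ?eqxx.
Qed.

Lemma edge_ends e : e \in simplices K 1 -> exists x y, x != y /\ e = [fset x; y]%fset.
Proof.
move=> /simplices_card; have := fset_uniq e; have : e =i enum_fset e by [].
case: (enum_fset e) => [|x [|y [|]]] //= eE /andP[xy _] _; exists x, y.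
rewrite inE in xy; split=> //; apply/fsetP => v; rewrite !inE.
by have := eE v; rewrite !inE => <-.
Qed.

Lemma face_edge f x y : f \in simplices K 2 -> x \in f -> y \in f -> x != y ->
  [fset x; y]%fset \in simplices K 1.
Proof.
move=> fK xf yf xy; rewrite in_fset inE /= cardfs2 xy eqxx andbT.
apply: (complex_face hK (simplices_sub fK)).
  by apply/fsubsetP => v; rewrite !inE => /orP[]/eqP->.
by move/fsetP/(_ x); rewrite !inE eqxx.
Qed.

(** The opposite directions of the edge in its two faces fix the sign of the
    dihedral angle: exchanging the roles of f and g also exchanges those of x and
    y. *)
Definition hinge e x y z w f g : Prop :=
  [/\ [/\ f \in simplices K 2, g \in simplices K 2 & f != g],
      e = [fset x; y]%fset,
      [/\ uniq [:: x; y; z], f =i [:: x; y; z], next (o f) x = y & next (o f) y = z],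
      [/\ uniq [:: y; x; w], g =i [:: y; x; w], next (o g) y = x & next (o g) x = w]
    & forall h, h \in simplices K 2 -> (e `<=` h)%fset -> h = f \/ h = g].

Lemma hinge_exists e : e \in simplices K 1 -> exists x y z w f g, hinge e x y z w f g.
Proof.
move=> eK; set H := [fset t in simplices K 2 | (e `<=` t)%fset]%fset.
have [f [g [fg HE]]] : exists f g, f != g /\ H =i [:: f; g].
  have := complex_edge hK eK; rewrite -/H; have := fset_uniq H.
  have : H =i enum_fset H by [].
  case: (enum_fset H) => [|f [|g [|]]] //= HE /andP[fg _] _; exists f, g.
  by rewrite inE in fg.
have inH h : (h \in H) = (h \in simplices K 2) && (e `<=` h)%fset.
  by rewrite in_fset.
have /andP[fK ef] : (f \in simplices K 2) && (e `<=` f)%fset by rewrite -inH HE !inE eqxx.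
have /andP[gK eg] : (g \in simplices K 2) && (e `<=` g)%fset.
  by rewrite -inH HE !inE eqxx orbT.
have only h : h \in simplices K 2 -> (e `<=` h)%fset -> h = f \/ h = g.
  move=> hK' eh; have := HE h; rewrite inH hK' eh !inE.
  by move=> /esym/orP[]/eqP; [left|right].
have [x [y [xy eE]]] : exists x y, x != y /\ e = [fset x; y]%fset /\ next (o f) x = y.
  have [x [y [xy eE]]] := edge_ends eK.
  have xf : x \in f by apply: (fsubsetP ef); rewrite eE !inE eqxx.
  have yf : y \in f by apply: (fsubsetP ef); rewrite eE !inE eqxx orbT.
  have [y' [z [u fE n1 n2 n3]]] := face_next fK xf.
  have [yy'|yy'] := eqVneq y' y; first by exists x, y; rewrite n1 yy'.
  exists y, x; rewrite eq_sym xy eE; split=> //; split.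
    by apply/fsetP => v; rewrite !inE orbC.
  have := fE y; rewrite yf !inE (eq_sym y x) (negPf xy) (eq_sym y) (negPf yy') /=.
  by move=> /esym/eqP->.
move: eE => [eE nf].
have xf : x \in f by apply: (fsubsetP ef); rewrite eE !inE eqxx.
have yg : y \in g by apply: (fsubsetP eg); rewrite eE !inE eqxx orbT.
have [y' [z [u fE n1 n2 n3]]] := face_next fK xf.
have [x' [w [u' gE n1' n2' n3']]] := face_next gK yg.
have y'E : y' = y by rewrite -n1.
have x'E : x' = x.
  rewrite -n1'; apply: (orientation_opposite ho _ fK gK _ _ _ nf); rewrite -?eE //.
  exact/eqP.
by rewrite y'E x'E in u fE n1 n2 n3 u' gE n1' n2' n3'; exists x, y, z, w, f, g; split.
Qed.

(** Each arc of an oriented face runs along exactly one edge, in one of its two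
    directions. *)
Lemma sum_hinges (V : zmodType) (Phi : {fset 'rV[R]_n} -> 'rV[R]_n -> 'rV[R]_n -> V)
    (hx hy hz hw : {fset 'rV[R]_n} -> 'rV[R]_n)
    (hf hg : {fset 'rV[R]_n} -> {fset 'rV[R]_n}) :
  (forall e, e \in simplices K 1 -> hinge e (hx e) (hy e) (hz e) (hw e) (hf e) (hg e)) ->
  \sum_(e <- simplices K 1) (Phi (hf e) (hx e) (hy e) + Phi (hg e) (hy e) (hx e)) =
  \sum_(f <- simplices K 2) \sum_(x <- o f) Phi f x (next (o f) x).
Proof.
move=> hE.
have arc_edge f x : f \in simplices K 2 -> x \in o f ->
    [fset x; next (o f) x]%fset \in simplices K 1.
  move=> fK; rewrite (orientation_vertices ho fK).2 => xf.
  have [y [z [u fE n1 _ _]]] := face_next fK xf.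
  rewrite n1; apply: face_edge fK xf _ _; first by rewrite fE !inE eqxx orbT.
  by move: u; rewrite /= !inE negb_or -andbA => /and3P[].
pose S f e := \sum_(x <- o f | [fset x; next (o f) x]%fset == e) Phi f x (next (o f) x).
transitivity (\sum_(e <- simplices K 1) \sum_(f <- simplices K 2) S f e); last first.
  rewrite exchange_big; apply: eq_big_seq => f fK /=.
  rewrite /S (exchange_big_dep predT) //=; apply: eq_big_seq => x xf.
  rewrite -big_filter (eq_filter (a2 := pred1 [fset x; next (o f) x]%fset)).
    by rewrite (filter_pred1_uniq (fset_uniq _) (arc_edge f x fK xf)) big_seq1.
  by move=> e; rewrite eq_sym.
apply: eq_big_seq => e eK; have [[fK gK fg] eE fh gh only] := hE e eK.
have S0 h : h \in simplices K 2 -> h != hf e -> h != hg e -> S h e = 0.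
  move=> hK' hf' hg'; rewrite /S big_seq_cond big1 // => x /andP[xh /eqP eh].
  have [] := only h hK'; last 2 first.
  - by move=> hE'; rewrite hE' eqxx in hf'.
  - by move=> hE'; rewrite hE' eqxx in hg'.
  rewrite -eh; apply/fsubsetP => v; rewrite !inE -!(orientation_vertices ho hK').2.
  by move=> /orP[]/eqP-> //; rewrite mem_next.
(* the other two arcs of the face meet the edge in one vertex only *)
have Sf h x y z : h \in simplices K 2 -> e = [fset x; y]%fset ->
    [/\ uniq [:: x; y; z], h =i [:: x; y; z], next (o h) x = y & next (o h) y = z] ->
    S h e = Phi h x y.
  move=> hK' eE' [u hE' n1 n2]; have [uo oE] := orientation_vertices ho hK'.
  move: u; rewrite /= !inE negb_or -andbA andbT => /and3P[xy xz yz].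
  have n3 : next (o h) z != y.
    apply: contraNneq xz => n3; apply/eqP; apply: (can_inj (prev_next uo)).
    by rewrite n1 n3.
  rewrite /S big_mkcond (bigD1_seq x) ?uo ?oE ?hE' ?inE ?eqxx //= n1 -eE' eqxx.
  rewrite big_seq_cond big1 ?addr0 // => v; rewrite oE hE' !inE => /andP[/or3P[]/eqP-> vx].
  - by rewrite eqxx in vx.
  - rewrite n2; case: eqP => // /fsetP/(_ x); rewrite eE' !inE eqxx.
    by rewrite (negPf xy) (negPf xz).
  - case: eqP => // /fsetP/(_ y); rewrite eE' !inE eqxx (negPf yz) orbT /=.
    by rewrite eq_sym (negPf n3).
rewrite (bigD1_seq (hf e) fK (fset_uniq _)) /= (Sf _ _ _ _ fK eE fh).
rewrite -big_filter (bigD1_seq (hg e)) ?filter_uniq ?fset_uniq ?mem_filter ?gK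
  ?(eq_sym (hg e)) ?fg //=.
have eE' : e = [fset hy e; hx e]%fset by rewrite fsetUC.
rewrite (Sf _ _ _ _ gK eE' gh) //.
rewrite big_seq_cond big1 ?addr0 // => h; rewrite mem_filter => /andP[/andP[hf' hK'] hg'].
by apply: S0.
Qed.
End OrientedComplex.

(** * Hinge numbers do not move algebraically *)

Section Hinges.
Variable R : realType.
Local Notation C := R[i].
Local Notation emb := (real_complex R).

Section HingeNumbers.
Variables (n : nat) (q : 'rV[R]_n -> 'rV[R]_3).
Implicit Types x y z w : 'rV[R]_n.

(** For a hinge with dihedral angle alpha, whose two faces have areas S and T,
    the pair (hinge_cos, length * hinge_sin) is 4 S T (cos alpha, sin alpha),
    up to the sign of alpha. *)
Definition hinge_cos x y z w : R :=
  dot (cross (q y - q x) (q z - q x)) (cross (q y - q x) (q w - q x)).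
Definition hinge_sin x y z w : R :=
  dot (cross (q y - q x) (q z - q x)) (q w - q x).

Definition hinge_number (l : R) x y z w : C :=
  (hinge_cos x y z w +i* (l * hinge_sin x y z w))%C.

Lemma hinge_numberE l x y z w (Q := fun v => map_mx emb (q v)) (d := Q y - Q x) :
  hinge_number l x y z w =
  dot (cross d (Q z - Q x)) (cross d (Q w - Q x))
  + 'i%C * emb l * dot (cross d (Q z - Q x)) (Q w - Q x).
Proof.
rewrite /d /Q -!map_mxB !cross_map_mx !dot_map_mx -mulrA -rmorphM.
by rewrite /hinge_number complexiE; simpc.
Qed.
End HingeNumbers.

Section Configuration.
Variables (n : nat) (K : {fset {fset 'rV[R]_n}}).
Variable o : {fset 'rV[R]_n} -> seq 'rV[R]_n.
Hypotheses (hK : strongly_connected_2complex K) (ho : consistent_orientation K o).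
Variables (q : 'rV[R]_n -> 'rV[R]_3) (l : {fset 'rV[R]_n} -> R).
Implicit Types (x y z w : 'rV[R]_n) (e f g h : {fset 'rV[R]_n}).

Hypothesis lengths : forall x y, [fset x; y]%fset \in simplices K 1 ->
  dot (q y - q x) (q y - q x) = l [fset x; y]%fset ^+ 2.
Hypothesis nondeg : forall f x y z, f \in simplices K 2 ->
  uniq [:: x; y; z] -> f =i [:: x; y; z] ->
  dot (cross (q y - q x) (q z - q x)) (cross (q y - q x) (q z - q x)) != 0.

(** The modulus of the hinge number is the product of the doubled areas of the
    two faces. *)
Lemma hinge_number_neq0 e x y z w f g : e \in simplices K 1 ->
  hinge K o e x y z w f g -> hinge_number q (l e) x y z w != 0.
Proof.
move=> eK [[fK gK _] eE [uf fE _ _] [ug gE _ _] _].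
have uf' : uniq [:: x; y; w].
  by move: ug; rewrite /= !inE !negb_or (eq_sym y x) => /and3P[/andP[-> ->] ->].
have gE' : g =i [:: x; y; w] by move=> v; rewrite gE !inE orbCA.
have := mulf_neq0 (nondeg fK uf fE) (nondeg gK uf' gE').
rewrite -hinge_norm lengths -?eE //.
apply: contraNneq => -[c0 s0]; rewrite -/(hinge_cos q x y z w) -/(hinge_sin q x y z w).
by rewrite c0 -exprMn s0 !expr0n addr0.
Qed.

Local Notation Q x := (map_mx emb (q x)).

(** D kills the edge lengths, so it moves each face like a rigid body. *)
Lemma face_angular_velocity (D : C -> C) f :
  derivation_along idfun D -> (forall e, e \in simplices K 1 -> D (emb (l e)) = 0) ->
  exists W, f \in simplices K 2 -> forall x y, x \in f -> y \in f ->
    map_mx D (Q y - Q x) = cross W (Q y - Q x).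
Proof.
move=> derD Dl; have [fK|] := boolP (f \in simplices K 2); last by exists 0.
have [x xf] : exists x, x \in f.
  by apply/fset0Pn; rewrite -cardfs_gt0 (simplices_card fK).
have [y [z [u fE _ _ _]]] := face_next ho fK xf.
have /and3P[xy xz yz] : [&& x != y, x != z & y != z].
  by move: u; rewrite /= !inE negb_or -andbA andbT.
have yf : y \in f by rewrite fE !inE eqxx orbT.
have zf : z \in f by rewrite fE !inE eqxx !orbT.
have rigid_edge v v' : v \in f -> v' \in f -> v != v' ->
    dot (Q v' - Q v) (map_mx D (Q v' - Q v)) = 0.
  move=> vf v'f vv'; have eK := face_edge hK fK vf v'f vv'.
  have : D (dot (Q v' - Q v) (Q v' - Q v)) = 0.
    rewrite -map_mxB dot_map_mx lengths // rmorphXn expr2 derD.2 /= Dl //.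
    by rewrite mul0r mulr0 addr0.
  rewrite (deriv_dot derD) dotC -mulr2n -mulr_natr => /eqP.
  by rewrite mulf_eq0 pnatr_eq0 orbF => /eqP.
have [||||W [Wy Wz]] := @angular_velocity_exists C (Q y - Q x) (Q z - Q x)
   (map_mx D (Q y - Q x)) (map_mx D (Q z - Q x)).
- by rewrite -!map_mxB !cross_map_mx dot_map_mx fmorph_eq0; apply: nondeg fK u fE.
- exact: rigid_edge.
- exact: rigid_edge.
- have yzE : Q z - Q y = (Q z - Q x) - (Q y - Q x) by rewrite opprB addrA subrK.
  have re := rigid_edge y z yf zf yz.
  rewrite yzE (map_mx_derivB derD) dotBl [dot (Q z - Q x) (_ - _)]dotBr in re.
  rewrite [dot (Q y - Q x) (_ - _)]dotBr !rigid_edge // sub0r subr0 -opprD in re.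
  by rewrite [dot _ (Q z - Q x)]dotC; apply/eqP; rewrite -oppr_eq0 re.
exists W => _ v v' vf v'f.
have base t : t \in f -> map_mx D (Q t - Q x) = cross W (Q t - Q x).
  rewrite fE !inE => /or3P[]/eqP-> //.
  rewrite subrr cross0r.
  by apply/rowP => i; rewrite !mxE (deriv_along0 derD).
have -> : Q v' - Q v = (Q v' - Q x) - (Q v - Q x) by rewrite opprB addrA subrK.
by rewrite (map_mx_derivB derD) !base // [RHS]crossBr.
Qed.

Lemma sum_next (V : zmodType) (p : seq 'rV[R]_n) (G : 'rV[R]_n -> V) : uniq p ->
  \sum_(x <- p) G (next p x) = \sum_(x <- p) G x.
Proof.
move=> up; rewrite -(big_map (next p) predT G); apply: perm_big.
apply: uniq_perm => //.
  by rewrite map_inj_uniq //; exact: can_inj (prev_next up).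
move=> v; apply/mapP/idP => [[x xp ->]|vp]; first by rewrite mem_next.
by exists (prev p v); rewrite ?mem_prev // next_prev.
Qed.

(** Summed over all edges, length times the derivative of the dihedral angle
    is a sum over the faces of the inner product of the angular velocity with the
    sum of the boundary edges, which is 0: the total mean curvature of a flexing
    polyhedron is stationary. *)
Theorem sum_dlog_hinge_number (D : C -> C)
    (hx hy hz hw : {fset 'rV[R]_n} -> 'rV[R]_n)
    (hf hg : {fset 'rV[R]_n} -> {fset 'rV[R]_n}) :
  (forall e, e \in simplices K 1 ->
     hinge K o e (hx e) (hy e) (hz e) (hw e) (hf e) (hg e)) ->
  derivation_along idfun D -> (forall e, e \in simplices K 1 -> D (emb (l e)) = 0) ->
  let U e := hinge_number q (l e) (hx e) (hy e) (hz e) (hw e) in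
  \sum_(e <- simplices K 1) emb (l e) * (D (U e) / U e) = 0.
Proof.
move=> hE derD Dl U.
have /choice[W WE] f := face_angular_velocity f derD Dl.
have im2 : ('i%C : C) ^+ 2 = -1 by rewrite sqr_i.
have nzi : ('i%C : C) != 0 by rewrite complexiE neq0Ci.
have Dim : D 'i%C = 0.
  have := congr1 D im2; rewrite (deriv_alongN derD) (deriv_along1 derD) oppr0.
  rewrite expr2 derD.2 /= mulrC -mulr2n -mulr_natr => /eqP.
  by rewrite !mulf_eq0 pnatr_eq0 orbF (negPf nzi) => /eqP.
pose Phi f x y := dot (W f) (Q y - Q x).
have termE e : e \in simplices K 1 -> emb (l e) * (D (U e) / U e) =
    - 'i%C * (Phi (hf e) (hx e) (hy e) + Phi (hg e) (hy e) (hx e)).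
  move=> eK; have nzU := hinge_number_neq0 eK (hE e eK).
  have [[fK gK _] eE [_ fE _ _] [_ gE _ _] _] := hE e eK.
  have -> : Phi (hf e) (hx e) (hy e) + Phi (hg e) (hy e) (hx e) =
      dot (W (hf e) - W (hg e)) (Q (hy e) - Q (hx e)).
    by rewrite /Phi -[Q (hx e) - _]opprB dotNr dotBl.
  apply: (mulIf nzU); rewrite mulrA divfK // /U hinge_numberE.
  have yf : hy e \in hf e by rewrite fE !inE eqxx orbT.
  have xf : hx e \in hf e by rewrite fE !inE eqxx.
  have zf : hz e \in hf e by rewrite fE !inE eqxx !orbT.
  have yg : hy e \in hg e by rewrite gE !inE eqxx.
  have xg : hx e \in hg e by rewrite gE !inE eqxx orbT.
  have wg : hw e \in hg e by rewrite gE !inE eqxx !orbT.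
  apply: (deriv_hinge derD) => //; try exact: WE.
  - by rewrite -!map_mxB dot_map_mx lengths -?eE // rmorphXn.
  - exact: Dl.
rewrite (eq_big_seq _ termE) -mulr_sumr (sum_hinges hK ho _ hE) big_seq big1 ?mulr0 //.
move=> f fK; rewrite -dot_sumr sumrB.
have [uo _] := orientation_vertices ho fK.
by rewrite (sum_next (fun v => Q v) uo) subrr dot0r.
Qed.

(** The stationarity of the total mean curvature under every derivation that
    kills A is the hypothesis of Rosenlicht's lemma, with the edge lengths as
    coefficients. *)
Theorem hinge_number_algebraic (A : set C) e x y z w f g :
  is_subfield A -> (forall e, e \in simplices K 1 -> A (emb (l e))) ->
  (forall m : {fset 'rV[R]_n} -> int,
     \sum_(e <- simplices K 1) l e * (m e)%:~R = 0 ->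
     forall e, e \in simplices K 1 -> m e = 0) ->
  e \in simplices K 1 -> hinge K o e x y z w f g ->
  algebraic_over A (hinge_number q (l e) x y z w).
Proof.
move=> fA Al indep eK eh.
(* one hinge for every edge, the given one for e *)
have /choice[h hE] e' : exists t : 'rV[R]_n * 'rV[R]_n * 'rV[R]_n * 'rV[R]_n *
      {fset 'rV[R]_n} * {fset 'rV[R]_n},
    (e' = e -> t = (x, y, z, w, f, g)) /\ (e' \in simplices K 1 ->
    hinge K o e' t.1.1.1.1.1 t.1.1.1.1.2 t.1.1.1.2 t.1.1.2 t.1.2 t.2).
  have [->|ne] := eqVneq e' e; first by exists (x, y, z, w, f, g).
  have [e'K|//] := boolP (e' \in simplices K 1); last first.
    by exists (x, y, z, w, f, g); split=> // e'E; rewrite e'E eqxx in ne.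
  have [x' [y' [z' [w' [f' [g' h']]]]]] := hinge_exists hK ho e'K.
  by exists (x', y', z', w', f', g'); split=> // e'E; rewrite e'E eqxx in ne.
pose U e := hinge_number q (l e)
  (h e).1.1.1.1.1 (h e).1.1.1.1.2 (h e).1.1.1.2 (h e).1.1.2.
have -> : hinge_number q (l e) x y z w = U e by rewrite /U (hE e).1.
have nzU e' : e' \in simplices K 1 -> U e' != 0.
  by move=> e'K; apply: hinge_number_neq0 e'K ((hE e').2 e'K).
pose I : finType := fset_sub_type (simplices K 1).
have inI (i : I) : val i \in simplices K 1 by exact: valP.
apply: (@dlog_relation_algebraic C A I (fun i => emb (l (val i))) (fun i => U (val i))
  (pchar_num _) fA _ _ _ _ [` eK]%fset).
- by move=> i; apply: Al.
- move=> m rel i.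
  pose m' e := if insub e is Some i then m i else 0.
  have m'E (j : I) : m' (val j) = m j by rewrite /m' valK.
  rewrite -m'E; apply: (indep m') => //.
  apply: (fmorph_inj emb); rewrite rmorph0 rmorph_sum -[RHS]rel big_seq_fsetE.
  by apply: eq_bigr => j _; rewrite rmorphM rmorph_int m'E.
- by move=> i; apply: nzU.
- move=> D derD DA.
  rewrite -(big_seq_fsetE _ _ predT (fun e => emb (l e) * (D (U e) / U e))).
  apply: sum_dlog_hinge_number derD _ => [e' e'K|e' e'K]; first exact: (hE e').2.
  exact/DA/Al.
Qed.
End Configuration.
End Hinges.

(** * Congruence of triangles as sets *)

Section Triangles.
Variable R : realType.

Definition hull3 (n : nat) (a b c : 'rV[R]_n) : set 'rV[R]_n :=
  [set v | exists r s t : R, [/\ 0 <= r, 0 <= s, 0 <= t, r + s + t = 1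
    & v = r *: a + s *: b + t *: c]].

Local Ltac row_ring := apply/rowP => ?; rewrite !mxE; ring.

Lemma hull3_vertex n (a b c : 'rV[R]_n) : hull3 a b c a.
Proof. by exists 1, 0, 0; split; rewrite ?ler01 ?addr0 ?scale0r ?scale1r ?addr0. Qed.

Lemma hull3_rot n (a b c : 'rV[R]_n) : hull3 a b c = hull3 b c a.
Proof.
apply/seteqP; split=> v [r [s [t [r0 s0 t0 rst ->]]]].
  by exists s, t, r; split=> //; [lra|row_ring].
by exists t, r, s; split=> //; [lra|row_ring].
Qed.

Lemma hull_triangle n (f : {fset 'rV[R]_n}) x y z :
  uniq [:: x; y; z] -> f =i [:: x; y; z] -> hull f = hull3 x y z.
Proof.
move=> u fE; have pf := fset_perm u fE.
have sumE (V : zmodType) (G : 'rV[R]_n -> V) : \sum_(v <- f) G v = G x + G y + G z.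
  by rewrite (perm_big _ pf) !big_cons big_nil /= addr0 addrA.
have /and3P[xy xz yz] : [&& x != y, x != z & y != z].
  by move: u; rewrite /= !inE negb_or -andbA andbT.
apply/seteqP; split=> v [].
  move=> w []; rewrite !sumE => w0 w1 <-; exists (w x), (w y), (w z).
  by split=> //; apply: w0; rewrite fE !inE eqxx ?orbT.
move=> r [s [t [r0 s0 t0 rst ->]]].
exists (fun v => if v == x then r else if v == y then s else t).
rewrite !sumE !eqxx (eq_sym y x) !(eq_sym z) (negPf xy) (negPf xz) (negPf yz).
by split=> // v' _; case: (v' == x) => //; case: (v' == y).
Qed.

Lemma affine_hull3 n m (f : 'rV[R]_n -> 'rV[R]_m) x y z r s t :
  affine_on (hull3 x y z) f -> 0 <= r -> 0 <= s -> 0 <= t -> r + s + t = 1 ->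
  f (r *: x + s *: y + t *: z) = r *: f x + s *: f y + t *: f z.
Proof.
move=> aff r0 s0 t0 rst.
have vz : hull3 x y z z by rewrite 2!hull3_rot; exact: hull3_vertex.
have vx := hull3_vertex x y z.
have vy : hull3 x y z y by rewrite hull3_rot; exact: hull3_vertex.
have [t1|t1] := eqVneq t 1.
  have [-> ->] : r = 0 /\ s = 0 by split; lra.
  by rewrite t1 !scale0r !add0r !scale1r.
have nz : 1 - t != 0 by rewrite subr_eq0 eq_sym.
have lt1 : 0 < 1 - t by rewrite subr_gt0 lt_neqAle t1; lra.
pose k := s / (1 - t).
have k01 : 0 <= k <= 1.
  by rewrite /k ler_pdivrMr // mul1r divr_ge0 //; lra.
have rE : r = (1 - t) * (1 - k) by rewrite /k; have -> : r = 1 - t - s; [lra|field].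
have sE : s = (1 - t) * k by rewrite /k mulrC divfK.
pose p := (1 - k) *: x + k *: y.
have fp : f p = (1 - k) *: f x + k *: f y by exact: aff.
have vp : hull3 x y z p.
  by exists (1 - k), k, 0; split; rewrite ?scale0r ?addr0 //; lra.
have -> : r *: x + s *: y = (1 - t) *: p by rewrite scalerDr !scalerA -rE -sE.
by rewrite aff // ?fp ?scalerDr ?scalerA -?rE -?sE //; apply/andP; split=> //; lra.
Qed.

Lemma image_hull3 n m (f : 'rV[R]_n -> 'rV[R]_m) x y z :
  affine_on (hull3 x y z) f -> f @` hull3 x y z = hull3 (f x) (f y) (f z).
Proof.
move=> aff; apply/seteqP; split=> v.
  by move=> [_ [r [s [t [r0 s0 t0 rst ->]]]] <-]; exists r, s, t;
    rewrite (affine_hull3 aff).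
move=> [r [s [t [r0 s0 t0 rst ->]]]]; exists (r *: x + s *: y + t *: z).
  by exists r, s, t.
exact: affine_hull3.
Qed.

Local Notation vec := 'rV[R]_3.
Implicit Types (a b c p v : vec).

Lemma dot_self_eq0 (u : vec) : (dot u u == 0) = (u == 0).
Proof.
apply/idP/eqP=> [|->]; last by rewrite dot0r.
rewrite psumr_eq0 => [/allP u0|i _]; last by rewrite -expr2 sqr_ge0.
apply/rowP => i; have := u0 i; rewrite mem_index_enum => /(_ isT).
by rewrite -expr2 sqrf_eq0 mxE => /eqP.
Qed.

Definition sqdist p v : R := dot (p - v) (p - v).

Lemma euclidean_distE p v : euclidean_dist p v = Num.sqrt (sqdist p v).
Proof.
by rewrite /euclidean_dist; congr Num.sqrt; apply: eq_bigr => i _; rewrite !mxE expr2.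
Qed.

Lemma dot_self_ge0 p : 0 <= dot p p.
Proof. by apply: sumr_ge0 => i _; rewrite -expr2 sqr_ge0. Qed.

Lemma isometryP (A : vec -> vec) :
  is_isometry A <-> forall p v, sqdist (A p) (A v) = sqdist p v.
Proof.
split=> iso p v; last by rewrite !euclidean_distE iso.
have := iso p v; rewrite !euclidean_distE => /eqP.
by rewrite eqr_sqrt ?dot_self_ge0 // => /eqP.
Qed.

(** An extreme point, expressed through distances alone: the two equations make
    v the midpoint of p and q. *)
Definition apex (X : set vec) v : Prop :=
  X v /\ forall p q, X p -> X q -> sqdist v p = sqdist v q ->
    sqdist p q = 4 * sqdist v p -> p = q.

Lemma apex_isometry (A : vec -> vec) X v :
  is_isometry A -> apex X v -> apex (A @` X) (A v).
Proof.
move=> /isometryP iso [Xv mid]; split; first by exists v.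
by move=> _ _ [p Xp <-] [q Xq <-]; rewrite !iso => e1 e2; rewrite (mid p q).
Qed.

(** If two distinct vertices have positive weight in v, then v is the midpoint
    of a segment parallel to the side between them. *)
Lemma apex_hull3 a b c v : apex (hull3 a b c) v -> v \in [:: a; b; c].
Proof.
have two a' b' c' r s t : apex (hull3 a' b' c') v -> 0 < r -> 0 < s -> 0 <= t ->
    r + s + t = 1 -> v = r *: a' + s *: b' + t *: c' -> a' = b'.
  move=> [_ mid] r0 s0 t0 rst vE; pose k := Num.min r s.
  have k0 : 0 < k by rewrite lt_min r0.
  have [kr ks] : k <= r /\ k <= s by rewrite !ge_min !lexx orbT.
  pose h := k *: (a' - b').
  have sq1 p : sqdist v (v + p) = dot p p.
    by rewrite /sqdist opprD addrA subrr sub0r dotNr dotC dotNr opprK.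
  have hull_vh e : e = 1 \/ e = -1 -> hull3 a' b' c' (v + e *: h).
    move=> eE; exists (r + e * k), (s - e * k), t.
    split; [| |exact: t0| |by rewrite vE /h; row_ring]; by case: eE => ->; lra.
  have /eqP : v + 1 *: h = v + -1 *: h.
    apply: mid; try (by apply: hull_vh; auto).
      by rewrite !sq1 scale1r scaleN1r dotNr dotC dotNr opprK.
    rewrite sq1 /sqdist opprD addrACA subrr add0r scale1r scaleN1r opprK.
    by rewrite dotDl !dotDr; ring.
  rewrite (inj_eq (addrI v)) -subr_eq0 -scalerBl opprK -mulr2n scaler_eq0 pnatr_eq0 /=.
  by rewrite scaler_eq0 gt_eqF //= subr_eq0 => /eqP.
move=> av; have [[r [s [t [r0 s0 t0 rst vE]]]] _] := av.
have ab : 0 < r -> 0 < s -> a = b by move=> r1 s1; apply: two av r1 s1 t0 rst vE.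
have bc : 0 < s -> 0 < t -> b = c.
  move=> s1 t1; apply: (two b c a s t r) => //; first by rewrite -hull3_rot.
    lra.
  by rewrite vE; row_ring.
have ca : 0 < t -> 0 < r -> c = a.
  move=> t1 r1; apply: (two c a b t r s) => //; first by rewrite hull3_rot.
    lra.
  by rewrite vE; row_ring.
rewrite !inE vE.
have pos (k : R) : 0 <= k -> k = 0 \/ 0 < k.
  by rewrite le_eqVlt => /orP[/eqP <-|]; [left|right].
have [r1|r1] := pos r r0; have [s1|s1] := pos s s0; have [t1|t1] := pos t t0.
- by exfalso; lra.
- have -> : t = 1 by lra.
  by rewrite r1 s1 !scale0r !add0r scale1r eqxx !orbT.
- have -> : s = 1 by lra.
  by rewrite r1 t1 !scale0r !add0r addr0 scale1r eqxx !orbT.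
- rewrite -(bc s1 t1) r1 scale0r add0r -scalerDl.
  by rewrite (_ : s + t = 1) ?scale1r ?eqxx ?orbT //; lra.
- have -> : r = 1 by lra.
  by rewrite s1 t1 !scale0r !addr0 scale1r eqxx.
- rewrite (ca t1 r1) s1 scale0r addr0 -scalerDl.
  by rewrite (_ : r + t = 1) ?scale1r ?eqxx ?orbT //; lra.
- rewrite -(ab r1 s1) t1 scale0r addr0 -scalerDl.
  by rewrite (_ : r + s = 1) ?scale1r ?eqxx ?orbT //; lra.
- by rewrite -(bc s1 t1) -(ab r1 s1) -!scalerDl rst scale1r eqxx.
Qed.

(** By the parallelogram law, p - a and q - a are opposite vectors; but both have
    nonnegative coordinates in the basis b - a, c - a. *)
Lemma hull3_apex a b c : cross (b - a) (c - a) != 0 -> apex (hull3 a b c) a.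
Proof.
set u := b - a; set w := c - a => nz; split.
  exact: hull3_vertex.
move=> p q [r [s [t [_ s0 t0 rst pE]]]] [r' [s' [t' [_ s'0 t'0 rst' qE]]]] e1 e2.
have pa : p - a = s *: u + t *: w.
  have rE : r = 1 - s - t by lra.
  by rewrite pE rE /u /w; row_ring.
have qa : q - a = s' *: u + t' *: w.
  have rE : r' = 1 - s' - t' by lra.
  by rewrite qE rE /u /w; row_ring.
have pq0 : (p - a) + (q - a) = 0.
  apply/eqP; rewrite -dot_self_eq0.
  have e3 : dot (p - a) (p - a) = dot (q - a) (q - a).
    by move: e1; rewrite /sqdist -opprB -[a - q]opprB !(dotNr, dotC (- _)) !opprK.
  have e4 : sqdist p q =
      dot (p - a) (p - a) - 2 * dot (p - a) (q - a) + dot (q - a) (q - a).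
    rewrite /sqdist (_ : p - q = (p - a) - (q - a)); last by row_ring.
    by move: (p - a) (q - a) => P' Q'; rewrite dotBl !dotBr [dot Q' P']dotC; ring.
  have e5 : sqdist a p = dot (p - a) (p - a).
    by rewrite /sqdist -[a - p]opprB dotNr dotC dotNr opprK.
  move: e2 e3; rewrite e4 e5; move: (p - a) (q - a) => P' Q' e2 e3.
  by apply/eqP; rewrite dotDl !dotDr [dot Q' P']dotC; lra.
have uw : (s + s') *: u + (t + t') *: w = 0.
  by rewrite -[RHS]pq0 pa qa; row_ring.
have cross0 k k' : k *: u + k' *: w = 0 -> k = 0 /\ k' = 0.
  move=> kk; have cross0l y : cross 0 y = 0 by rewrite crossC cross0r oppr0.
  have := cross_comb k k' 0 1 u w; have := cross_comb k k' 1 0 u w.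
  rewrite kk !cross0l !mulr0 !mulr1 subr0 sub0r => /esym/eqP + /esym/eqP.
  by rewrite !scaler_eq0 (negPf nz) !orbF oppr_eq0 => /eqP-> /eqP->.
have [ss tt] := cross0 _ _ uw.
have [s1 t1] : s = 0 /\ t = 0 by split; lra.
have [s1' t1'] : s' = 0 /\ t' = 0 by split; lra.
by apply/eqP; rewrite -(inj_eq (subIr a)) pa qa s1 t1 s1' t1'.
Qed.

Lemma hull3_apexP a b c v : cross (b - a) (c - a) != 0 ->
  apex (hull3 a b c) v <-> v \in [:: a; b; c].
Proof.
move=> nz; split; first exact: apex_hull3.
rewrite !inE => /or3P[]/eqP->; first exact: hull3_apex.
  by rewrite hull3_rot; apply: hull3_apex; rewrite cross_rot.
by rewrite 2!hull3_rot; apply: hull3_apex; rewrite 2!cross_rot.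
Qed.

Lemma cross_neq0_uniq a b c : cross (b - a) (c - a) != 0 -> uniq [:: a; b; c].
Proof.
move=> nz; rewrite /= !inE negb_or andbT -andbA; apply/and3P; split;
  apply: contraNneq nz => e; rewrite e ?subrr ?cross0r ?crossvv //.
by rewrite crossC cross0r oppr0.
Qed.

(** The vertices of a triangle are its apexes, and a congruence preserves
    these. *)
Lemma congruent_triangle_vertices (A : vec -> vec) a b c a' b' c' :
  is_isometry A -> cross (b - a) (c - a) != 0 ->
  A @` hull3 a b c = hull3 a' b' c' ->
  {subset [:: a'; b'; c'] <= [:: A a; A b; A c]}.
Proof.
move=> isoA nz imA; have apexP v := hull3_apexP v nz.
have sub : {subset [:: A a; A b; A c] <= [:: a'; b'; c']}.
  have im v : v \in [:: a; b; c] -> A v \in [:: a'; b'; c'].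
    by move=> /apexP/(apex_isometry isoA); rewrite imA => /apex_hull3.
  by move=> _ /(mapP (s := [:: a; b; c]))[v /im vA ->].
have injA : injective A.
  move=> p v e; apply/eqP; rewrite -subr_eq0 -dot_self_eq0 -[dot _ _]/(sqdist p v).
  by move/isometryP: isoA => <-; rewrite e /sqdist subrr dot0r.
have uA : uniq [:: A a; A b; A c].
  by rewrite (map_inj_uniq injA [:: a; b; c]) cross_neq0_uniq.
by have [_ eqA] := uniq_min_size uA sub (leqnn _); move=> v; rewrite eqA.
Qed.

(** All differences of points of the hull are combinations of b - a and c - a,
    so if these are parallel, the hull contains no three independent points. *)
Lemma nondegenerate_triangle_cross a b c :
  nondegenerate_triangle (hull3 a b c) -> cross (b - a) (c - a) != 0.
Proof.
move=> [s [s3 ind hE]].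
have [x [y [z [us sE]]]] : exists x y z, uniq [:: x; y; z] /\ s =i [:: x; y; z].
  have := fset_uniq s; have : s =i enum_fset s by [].
  move: s3; case: (enum_fset s) => [|x [|y [|z []]]] // _ sE us.
  by exists x, y, z.
have /and3P[xy xz yz] : [&& x != y, x != z & y != z].
  by move: us; rewrite /= !inE negb_or -andbA andbT.
have sumE (V : zmodType) (G : vec -> V) : \sum_(v <- s) G v = G x + G y + G z.
  by rewrite (perm_big _ (fset_perm us sE)) !big_cons big_nil /= addr0 addrA.
have nxyz : cross (y - x) (z - x) != 0.
  apply/eqP=> n0; pose u := y - x; pose w := z - x.
  (* the weights of the relation (w . w) u - (u . w) w = w x (u x w) = 0 *)
  pose G v := if v == x then dot u w - dot w w else if v == y then dot w w else - dot u w.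
  have [Gx Gy Gz] : [/\ G x = dot u w - dot w w, G y = dot w w & G z = - dot u w].
    by rewrite /G !eqxx (eq_sym y x) !(eq_sym z) (negPf xy) (negPf xz) (negPf yz).
  have : dot w w *: u - dot u w *: w = 0.
    by rewrite -cross_crossr n0 cross0r.
  move=> lin; have := ind G; rewrite !sumE Gx Gy Gz => indG.
  have ww : dot w w = 0.
    rewrite -Gy; apply: indG; [by ring| |by rewrite sE !inE eqxx orbT].
    by rewrite -[RHS]lin /u /w; row_ring.
  move/eqP: ww; rewrite dot_self_eq0 subr_eq0 eq_sym => /eqP zx.
  by rewrite zx eqxx in xz.
have inh v : v \in [:: x; y; z] -> exists k k', v - a = k *: (b - a) + k' *: (c - a).
  move=> vs; have : hull3 a b c v.
    by rewrite hE (hull_triangle us sE); have [] := (hull3_apexP v nxyz).2 vs.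
  move=> [r [k [k' [_ _ _ rst ->]]]]; exists k, k'.
  by have -> : r = 1 - k - k' by [lra]; row_ring.
have [kx [kx' xE]] := inh x (mem_head _ _).
have [|ky [ky' yE]] := inh y; first by rewrite !inE eqxx orbT.
have [|kz [kz' zE]] := inh z; first by rewrite !inE eqxx !orbT.
apply: contraNneq nxyz => n0.
have -> : y - x = (ky - kx) *: (b - a) + (ky' - kx') *: (c - a).
  by transitivity ((y - a) - (x - a)); [row_ring|rewrite yE xE; row_ring].
have -> : z - x = (kz - kx) *: (b - a) + (kz' - kx') *: (c - a).
  by transitivity ((z - a) - (x - a)); [row_ring|rewrite zE xE; row_ring].
by rewrite cross_comb n0 scaler0.
Qed.
End Triangles.

Section ContinuousPaths.
Variable R : realType.
Let I : set R := [set` `[0, 1]].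

Definition continuous_path (u : R -> 'rV[R]_3) : Prop :=
  forall i, {within I, continuous (fun t => u t 0 i)}.

Let contD (f g : R -> R) : {within I, continuous f} -> {within I, continuous g} ->
  {within I, continuous (fun t => f t + g t)}.
Proof. by move=> cf cg t; apply: cvgD; [exact: cf|exact: cg]. Qed.

Let contB (f g : R -> R) : {within I, continuous f} -> {within I, continuous g} ->
  {within I, continuous (fun t => f t - g t)}.
Proof. by move=> cf cg t; apply: cvgB; [exact: cf|exact: cg]. Qed.

Let contM (f g : R -> R) : {within I, continuous f} -> {within I, continuous g} ->
  {within I, continuous (fun t => f t * g t)}.
Proof. by move=> cf cg t; apply: cvgM; [exact: cf|exact: cg]. Qed.

Lemma continuous_pathB u v : continuous_path u -> continuous_path v ->
  continuous_path (fun t => u t - v t).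
Proof.
move=> cu cv i; have -> : (fun t => (u t - v t) 0 i) = (fun t => u t 0 i - v t 0 i).
  by apply/funext => t; rewrite !mxE.
exact: contB.
Qed.

Lemma continuous_path_dot u v : continuous_path u -> continuous_path v ->
  {within I, continuous (fun t => dot (u t) (v t))}.
Proof.
move=> cu cv.
have -> : (fun t => dot (u t) (v t)) = (fun t => u t 0 ord0 * v t 0 ord0
    + (u t 0 (lift ord0 ord0) * v t 0 (lift ord0 ord0)
    + u t 0 (lift ord0 (lift ord0 ord0)) * v t 0 (lift ord0 (lift ord0 ord0)))).
  by apply/funext => t; rewrite /dot !big_ord_recl big_ord0 addr0.
by do 2?apply: contD; apply: contM.
Qed.

Lemma continuous_path_cross u v : continuous_path u -> continuous_path v ->
  continuous_path (fun t => cross (u t) (v t)).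
Proof.
move=> cu cv [[|[|[|//]]] lti]; set i := Ordinal lti.
- have -> : (fun t => cross (u t) (v t) 0 i) = (fun t =>
      u t 0 (inord 1) * v t 0 (inord 2) - u t 0 (inord 2) * v t 0 (inord 1)).
    by apply/funext => t; rewrite mxE.
  by apply: contB; apply: contM.
- have -> : (fun t => cross (u t) (v t) 0 i) = (fun t =>
      u t 0 (inord 2) * v t 0 (inord 0) - u t 0 (inord 0) * v t 0 (inord 2)).
    by apply/funext => t; rewrite mxE.
  by apply: contB; apply: contM.
- have -> : (fun t => cross (u t) (v t) 0 i) = (fun t =>
      u t 0 (inord 0) * v t 0 (inord 1) - u t 0 (inord 1) * v t 0 (inord 0)).
    by apply/funext => t; rewrite mxE.
  by apply: contB; apply: contM.
Qed.

Lemma continuous_path_countable (h : R -> R) (A : set R) :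
  {within I, continuous h} -> countable A -> (forall t, 0 <= t <= 1 -> A (h t)) ->
  forall t, 0 <= t <= 1 -> h t = h 0.
Proof.
move=> ch cA hA; apply: continuous_countable_image_const ch _.
apply: sub_countable cA; apply: subset_card_le => _ [t It <-]; apply: hA.
by move: It; rewrite /= in_itv.
Qed.

Lemma flex_path_continuous n (K : {fset {fset 'rV[R]_n}}) P Pt x :
  flex K P Pt -> body K x -> continuous_path (Pt^~ x).
Proof.
move=> fl Kx i; apply/subspace_continuousP => t It.
have tI : 0 <= t <= 1 by move: It; rewrite /I /= in_itv.
have /subspace_continuousP/(_ (t, x) (conj tI Kx)) /= cP := flex_continuous fl.
have cc := @coord_continuous R 1 3 0 i (Pt t x).
move=> W /cc /cP /=; rewrite /nbhs /= => H.
case: H => -[A B] /= [nA nB] sub; apply: filterS nA => s As Is.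
apply: (sub (s, x)); first by split=> //=; exact: nbhs_singleton nB.
by split=> //=; move: Is; rewrite /I /= in_itv.
Qed.
End ContinuousPaths.

(** * Flexes *)

Section Rigidity.
Variables (R : realType) (n : nat) (K : {fset {fset 'rV[R]_n}}).
Variables (o : {fset 'rV[R]_n} -> seq 'rV[R]_n) (P : 'rV[R]_n -> 'rV[R]_3).
Hypotheses (hK : strongly_connected_2complex K) (ho : consistent_orientation K o).
Hypotheses (hnd : nondegenerate_faces K P) (hQ : Q_independent_edge_lengths K P).
Variable Pt : R -> 'rV[R]_n -> 'rV[R]_3.
Hypothesis fl : flex K P Pt.
Implicit Types (x y z w v : 'rV[R]_n) (e f g : {fset 'rV[R]_n}) (t : R).

Lemma hullS f g : (f `<=` g)%fset -> hull f `<=` hull g.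
Proof.
move=> fg x [w [w0 w1 <-]]; exists (fun v => if v \in f then w v else 0).
have sumE (V : zmodType) (G : 'rV[R]_n -> V) :
    \sum_(v <- g) (if v \in f then G v else 0) = \sum_(v <- f) G v.
  rewrite -big_mkcond -big_filter; apply: perm_big; apply: uniq_perm.
  - by rewrite filter_uniq ?fset_uniq.
  - exact: fset_uniq.
  - by move=> v; rewrite mem_filter andb_idr // => /(fsubsetP fg).
split; first by move=> v _; case: ifP => // /w0.
- by rewrite sumE.
- rewrite -[RHS]sumE; apply: eq_bigr => v _; case: ifP => // _; exact: scale0r.
Qed.

Lemma face_body f : f \in simplices K 2 -> hull f `<=` body K.
Proof. by move=> fK v vf; exists f => //; apply: simplices_sub fK. Qed.

Lemma vertex_body f x : f \in simplices K 2 -> x \in f -> body K x.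
Proof.
move=> fK xf; have [y [z [u fE _ _ _]]] := face_next ho fK xf.
by apply: (face_body fK); rewrite (hull_triangle u fE); exact: hull3_vertex.
Qed.

Lemma flex_face t f x y z : 0 <= t <= 1 -> f \in simplices K 2 ->
  uniq [:: x; y; z] -> f =i [:: x; y; z] -> affine_on (hull3 x y z) (Pt t).
Proof.
move=> t01 fK u fE; rewrite -(hull_triangle u fE).
exact: (flex_polyhedron fl t01) (simplices_sub fK).
Qed.

Lemma zero01 : 0 <= (0 : R) <= 1. Proof. by rewrite lexx ler01. Qed.

Lemma start_nondegenerate f x y z : f \in simplices K 2 ->
  uniq [:: x; y; z] -> f =i [:: x; y; z] ->
  cross (Pt 0 y - Pt 0 x) (Pt 0 z - Pt 0 x) != 0.
Proof.
move=> fK u fE; apply: nondegenerate_triangle_cross.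
rewrite -(image_hull3 (flex_face zero01 fK u fE)) -(hull_triangle u fE).
have -> : Pt 0 @` hull f = P @` hull f.
  by apply: eq_imagel => v /(face_body fK); exact: (flex_start fl).
exact: hnd.
Qed.

(** The congruence of the faces may permute their vertices; but then each length
    takes finitely many values, and it varies continuously. *)
Lemma flex_sqdist f x y t : f \in simplices K 2 -> x \in f -> y \in f ->
  0 <= t <= 1 -> sqdist (Pt t x) (Pt t y) = sqdist (Pt 0 x) (Pt 0 y).
Proof.
move=> fK xf yf t01.
pose s := [seq sqdist (Pt 0 u) (Pt 0 v) | u <- enum_fset f, v <- enum_fset f].
apply: (@continuous_path_countable R (fun t => sqdist (Pt t x) (Pt t y)) [set` s]) => //.
- by apply: continuous_path_dot; apply: continuous_pathB;
    apply: (flex_path_continuous fl); apply: vertex_body fK _.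
- exact: finite_set_countable (finite_seq s).
move=> t' t'01 /=; have [->|t0] := eqVneq t' 0.
  by apply/allpairsP; exists (x, y).
have [a af] : exists a, a \in f by exists x.
have [b [c [u fE _ _ _]]] := face_next ho fK af.
have t_pos : 0 < t' <= 1 by move: t'01 => /andP[t_ge0 ->]; rewrite lt_def t0 t_ge0.
have [A isoA] := flex_congruent fl fK t_pos.
rewrite (hull_triangle u fE) (image_hull3 (flex_face zero01 fK u fE)).
rewrite (image_hull3 (flex_face t'01 fK u fE)) => imA.
have sub := congruent_triangle_vertices isoA (start_nondegenerate fK u fE) imA.
have vertexA v : v \in f -> exists2 v', v' \in f & Pt t' v = A (Pt 0 v').
  move=> vf; have /mapP[v' v's ->] : Pt t' v \in map (A \o Pt 0) [:: a; b; c].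
    by apply: sub; apply: (map_f (Pt t') (s := [:: a; b; c])); rewrite -fE.
  by exists v'; rewrite ?fE.
have [x' x'f ->] := vertexA x xf; have [y' y'f ->] := vertexA y yf.
apply/allpairsP; exists (x', y'); split=> //=.
by have /isometryP-> := isoA.
Qed.

Lemma flex_dot f x y z t : f \in simplices K 2 -> x \in f -> y \in f -> z \in f ->
  0 <= t <= 1 -> dot (Pt t y - Pt t x) (Pt t z - Pt t x) =
                 dot (Pt 0 y - Pt 0 x) (Pt 0 z - Pt 0 x).
Proof.
move=> fK xf yf zf t01.
have polar t' : dot (Pt t' y - Pt t' x) (Pt t' z - Pt t' x) =
    (sqdist (Pt t' y) (Pt t' x) + sqdist (Pt t' z) (Pt t' x)
     - sqdist (Pt t' y) (Pt t' z)) / 2.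
  have -> : sqdist (Pt t' y) (Pt t' z) =
      sqdist (Pt t' y) (Pt t' x) + sqdist (Pt t' z) (Pt t' x)
      - 2 * dot (Pt t' y - Pt t' x) (Pt t' z - Pt t' x).
    rewrite /sqdist (_ : Pt t' y - Pt t' z = (Pt t' y - Pt t' x) - (Pt t' z - Pt t' x)).
      move: (Pt t' y - Pt t' x) (Pt t' z - Pt t' x) => p r.
      by rewrite dotBl !dotBr [dot r p]dotC; ring.
    by rewrite opprB addrA subrK.
  by field.
by rewrite !polar !(flex_sqdist fK _ _ t01).
Qed.

Lemma flex_nondegenerate t f x y z : 0 <= t <= 1 -> f \in simplices K 2 ->
  uniq [:: x; y; z] -> f =i [:: x; y; z] ->
  dot (cross (Pt t y - Pt t x) (Pt t z - Pt t x))
      (cross (Pt t y - Pt t x) (Pt t z - Pt t x)) != 0.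
Proof.
move=> t01 fK u fE.
have [xf yf zf] : [/\ x \in f, y \in f & z \in f] by rewrite !fE !inE !eqxx !orbT.
rewrite dot_cross_cross !(flex_dot fK _ _ _ t01) // -dot_cross_cross.
by rewrite dot_self_eq0 (start_nondegenerate fK u fE).
Qed.

Lemma edge_lengthE e x y : x != y -> e = [fset x; y]%fset ->
  edge_length P e ^+ 2 = sqdist (P x) (P y).
Proof.
move=> xy eE.
have : perm_eq (enum_fset e) [:: x; y].
  by apply: fset_perm => [|v]; rewrite ?eE /= !inE ?andbT.
rewrite /edge_length !euclidean_distE sqr_sqrtr ?dot_self_ge0 //.
have sym p r : sqdist p r = sqdist r p by rewrite /sqdist -opprB dotNr dotC dotNr opprK.
case: (enum_fset e) (fset_uniq e) => [|a [|b [|c s]]] /= ue pe;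
  try by have := perm_size pe.
have := perm_mem pe a; have := perm_mem pe b; rewrite !inE !eqxx !orbT /=.
move: ue; rewrite inE andbT => ab /esym/orP[]/eqP bE /esym/orP[]/eqP aE; subst a b => //;
by rewrite eqxx in ab.
Qed.

Lemma flex_edge_length t x y : 0 <= t <= 1 -> [fset x; y]%fset \in simplices K 1 ->
  dot (Pt t y - Pt t x) (Pt t y - Pt t x) = edge_length P [fset x; y]%fset ^+ 2.
Proof.
move=> t01 eK; have [f fK ef] := complex_pure hK (simplices_sub eK).
have xf : x \in f by apply: (fsubsetP ef); rewrite !inE eqxx.
have yf : y \in f by apply: (fsubsetP ef); rewrite !inE eqxx orbT.
have xy : x != y.
  by have := simplices_card eK; rewrite cardfs2; case: eqP.
rewrite -[LHS]/(sqdist (Pt t y) (Pt t x)) (flex_sqdist fK yf xf t01).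
rewrite (@edge_lengthE _ y x) ?(eq_sym y) //; last by rewrite fsetUC.
by rewrite !(flex_start fl) //; apply: vertex_body fK _.
Qed.

(** The hinge numbers are algebraic over the field generated by the lengths,
    so they take countably many values; and they vary continuously. *)
Lemma flex_hinge_constant e x y z w f g t : e \in simplices K 1 ->
  hinge K o e x y z w f g -> 0 <= t <= 1 ->
  hinge_cos (Pt t) x y z w = hinge_cos (Pt 0) x y z w /\
  hinge_sin (Pt t) x y z w = hinge_sin (Pt 0) x y z w.
Proof.
move=> eK eh t01; have [[fK gK _] eE [u fE _ _] [u' gE _ _] _] := eh.
pose l := edge_length P.
have [A [fA Al cA]] := @countable_algebraic_closure R[i] (fset_sub_type (simplices K 1))
  (fun i => real_complex R (l (val i))).
have alg t' : 0 <= t' <= 1 -> algebraic_over A (hinge_number (Pt t') (l e) x y z w).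
  move=> t'01; apply: (hinge_number_algebraic hK ho _ _ fA _ _ eK eh).
  - by move=> x' y'; exact: flex_edge_length.
  - by move=> f' x' y' z'; exact: flex_nondegenerate.
  - by move=> e' e'K; exact: (Al [` e'K]%fset).
  - move=> m rel e' e'K.
    suff /eqP : (m e')%:~R = 0 :> rat by rewrite intr_eq0 => /eqP.
    apply: (hQ (c := fun e => (m e)%:~R)) e'K.
    by rewrite -[RHS]rel; apply: eq_bigr => i _; rewrite ratr_int mulrC.
have path v : v \in f \/ v \in g -> continuous_path (Pt^~ v).
  by move=> vfg; apply: (flex_path_continuous fl); case: vfg; apply: vertex_body.
have [px py pz pw] : [/\ continuous_path (Pt^~ x), continuous_path (Pt^~ y),
    continuous_path (Pt^~ z) & continuous_path (Pt^~ w)].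
  by split; apply: path; rewrite fE gE !inE !eqxx ?orbT; auto.
have cn : continuous_path (fun t => cross (Pt t y - Pt t x) (Pt t z - Pt t x)).
  by apply: continuous_path_cross; apply: continuous_pathB.
have nzl : l e != 0.
  have xy : x != y by move: u; rewrite /= !inE negb_or => /and3P[/andP[]].
  have := flex_nondegenerate zero01 fK u fE; apply: contraNneq => l0.
  have : dot (Pt 0 y - Pt 0 x) (Pt 0 y - Pt 0 x) = 0.
    by rewrite flex_edge_length ?zero01 -?eE // -/(l e) l0 expr0n.
  move=> d0; have := dot_self_eq0 (Pt 0 y - Pt 0 x); rewrite d0 eqxx => /esym/eqP->.
  by rewrite crossC cross0r oppr0 dot0r.
split.
  apply: (@continuous_path_countable R (fun t => hinge_cos (Pt t) x y z w)
    (@complex.Re R @` [set a | algebraic_over A a])) t01.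
  - by apply: continuous_path_dot => //; apply: continuous_path_cross;
      apply: continuous_pathB.
  - exact: sub_countable (card_image_le _ _) cA.
  - by move=> t' /alg a; exists (hinge_number (Pt t') (l e) x y z w).
apply: (@continuous_path_countable R (fun t => hinge_sin (Pt t) x y z w)
  ((fun a => complex.Im a / l e) @` [set a | algebraic_over A a])) t01.
- by apply: continuous_path_dot => //; apply: continuous_pathB.
- exact: sub_countable (card_image_le _ _) cA.
- move=> t' /alg a; exists (hinge_number (Pt t') (l e) x y z w) => //.
  by rewrite /hinge_number /= [l e * _]mulrC mulfK.
Qed.

(** Two adjacent faces share an edge, and the constant hinge data determine the
    position of the remaining vertex of one relative to the other. *)
Lemma flex_motion_step t (phi : 'rV[R]_3 -> 'rV[R]_3) x0 f g :
  0 <= t <= 1 -> proper_rotation phi ->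
  f \in simplices K 2 -> g \in simplices K 2 -> share_edge K f g ->
  {in f, forall v, Pt t v - Pt t x0 = phi (Pt 0 v - Pt 0 x0)} ->
  {in g, forall v, Pt t v - Pt t x0 = phi (Pt 0 v - Pt 0 x0)}.
Proof.
move=> t01 rot fK gK eK good_f.
have phiD p r := proper_rotationD p r rot; have phiB p r := proper_rotationB p r rot.
have subx (s : R) p r : Pt s p - Pt s r = (Pt s p - Pt s x0) - (Pt s r - Pt s x0).
  by rewrite opprB addrA subrK.
have motion p r : p \in f -> r \in f -> Pt t p - Pt t r = phi (Pt 0 p - Pt 0 r).
  by move=> pf rf; rewrite (subx t) (subx 0) phiB !good_f.
have [x [y [z [w [F [G eh]]]]]] := hinge_exists hK ho eK.
have [cE sE] := flex_hinge_constant eK eh t01.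
have [[FK GK _] eE [u FE _ _] [u' GE _ _] only] := eh.
have /only Hf : f \in simplices K 2 by []; have /only Hg : g \in simplices K 2 by [].
have {}Hf := Hf (fsubsetIl _ _); have {}Hg := Hg (fsubsetIr _ _).
have [fg|fg] := eqVneq f g; first by rewrite -fg.
have xyf : x \in f /\ y \in f.
  have /fsubsetP sub := fsubsetIl f g.
  by split; apply: sub; rewrite eE !inE eqxx ?orbT.
move: xyf => [xf yf].
have [xG yG wG] : [/\ x \in G, y \in G & w \in G] by rewrite !GE !inE !eqxx !orbT.
have [xF yF zF] : [/\ x \in F, y \in F & z \in F] by rewrite !FE !inE !eqxx !orbT.
have u'' : uniq [:: x; y; w].
  by move: u'; rewrite /= !inE !negb_or (eq_sym y x) => /and3P[/andP[-> ->] ->].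
have GE' : G =i [:: x; y; w] by move=> v; rewrite GE !inE orbCA.
have nzd : dot (Pt 0 y - Pt 0 x) (Pt 0 y - Pt 0 x) != 0.
  have := start_nondegenerate FK u FE; rewrite dot_self_eq0; apply: contraNneq => ->.
  by rewrite crossC cross0r oppr0.
have extend v : Pt t v - Pt t x = phi (Pt 0 v - Pt 0 x) ->
    Pt t v - Pt t x0 = phi (Pt 0 v - Pt 0 x0).
  move=> e; have splitx s : Pt s v - Pt s x0 = (Pt s v - Pt s x) + (Pt s x - Pt s x0).
    by rewrite addrA subrK.
  by rewrite !splitx e good_f // phiD.
case: Hf Hg => fE [] gE; try by rewrite fE gE eqxx in fg.
- rewrite gE => v; rewrite GE !inE => /or3P[]/eqP->; [exact: good_f|exact: good_f|].
  apply: extend; rewrite fE in motion xf yf.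
  apply: (proper_rotation_hinge rot nzd (flex_nondegenerate zero01 FK u FE)).
  + by rewrite -motion // (flex_dot GK xG yG wG t01).
  + by rewrite -!motion //; exact: cE.
  + by rewrite -!motion //; exact: sE.
- rewrite gE => v; rewrite FE !inE => /or3P[]/eqP->; [exact: good_f|exact: good_f|].
  apply: extend; rewrite fE in motion xf yf.
  apply: (proper_rotation_hinge rot nzd (flex_nondegenerate zero01 GK u'' GE')).
  + by rewrite -motion // (flex_dot FK xF yF zF t01).
  + by rewrite -!motion // dotC [RHS]dotC; exact: cE.
  + by rewrite -!motion // dot_crossC [RHS]dot_crossC; congr (- _); exact: sE.
Qed.
End Rigidity.

Theorem theorem2 (R : realType) (n : nat) (K : {fset {fset 'rV[R]_n}})
    (o : {fset 'rV[R]_n} -> seq 'rV[R]_n) (P : 'rV[R]_n -> 'rV[R]_3)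
    (hK : strongly_connected_2complex K)
    (ho : consistent_orientation K o)
    (hP : polyhedron K P)
    (hnd : nondegenerate_faces K P)
    (hQ : Q_independent_edge_lengths K P) :
  rigid K P.
Proof.
move=> Pt fl t t_pos.
have t01 : 0 <= t <= 1 by move: t_pos => /andP[t0 ->]; rewrite ltW.
have [s0 s0K] : exists s, s \in K.
  by apply/fset0Pn/eqP; exact: complex_nonempty hK.
have [f0 f0K _] := complex_pure hK s0K.
have [x0 x0f] : exists x, x \in f0.
  by apply/fset0Pn; rewrite -cardfs_gt0 (simplices_card f0K).
have [y0 [z0 [u0 f0E _ _ _]]] := face_next ho f0K x0f.
have [y0f z0f] : y0 \in f0 /\ z0 \in f0 by rewrite !f0E !inE !eqxx !orbT.
have [|||| phi rot [phi_y phi_z]] := @proper_rotation_exists R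
  (Pt 0 y0 - Pt 0 x0) (Pt 0 z0 - Pt 0 x0) (Pt t y0 - Pt t x0) (Pt t z0 - Pt t x0).
- exact: (flex_nondegenerate ho hnd fl (zero01 R) f0K u0 f0E).
- by rewrite (flex_dot ho hnd fl f0K x0f y0f y0f t01).
- by rewrite (flex_dot ho hnd fl f0K x0f y0f z0f t01).
- by rewrite (flex_dot ho hnd fl f0K x0f z0f z0f t01).
pose good (f : {fset 'rV[R]_n}) :=
  {in f, forall v, Pt t v - Pt t x0 = phi (Pt 0 v - Pt 0 x0)}.
have good_f0 : good f0.
  move=> v; rewrite f0E !inE => /or3P[]/eqP-> //.
  by rewrite !subrr -[X in phi X](scale0r 0) (proper_rotationZ _ _ rot) scale0r.
have good_all g : g \in simplices K 2 -> good g.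
  move=> gK; have [p [pK pp <-]] := complex_connected hK f0K gK.
  elim: p {gK} f0 f0K good_f0 pK pp {x0f u0 f0E y0f z0f} => [|g' p IHp] f fK good_f //=.
  move=> pK /andP[fg' pp]; have g'K := pK g' (mem_head _ _).
  apply: (IHp _ g'K _ _ pp); last by move=> h hp; apply: pK; rewrite inE hp orbT.
  exact: (flex_motion_step hK ho hnd hQ fl t01 rot fK g'K fg' good_f).
exists (fun p => phi (p - Pt 0 x0) + Pt t x0).
  apply/isometryP => p v; have [_ iso _] := rot.
  rewrite /sqdist opprD addrACA subrr addr0 -(proper_rotationB _ _ rot) iso.
  by rewrite opprB addrA subrK.
move=> x [s sK sx]; have [f fK sf] := complex_pure hK sK.
have [a af] : exists a, a \in f.
  by apply/fset0Pn; rewrite -cardfs_gt0 (simplices_card fK).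
have [b [c [u fE _ _ _]]] := face_next ho fK af.
have [bf cf] : b \in f /\ c \in f by rewrite !fE !inE !eqxx !orbT.
have : hull3 a b c x by rewrite -(hull_triangle u fE); exact: hullS sf x sx.
move=> [k1 [k2 [k3 [k1_ge0 k2_ge0 k3_ge0 k123 ->]]]].
rewrite (affine_hull3 (flex_face fl t01 fK u fE)) //.
rewrite (affine_hull3 (flex_face fl (zero01 R) fK u fE)) //.
have moved v : v \in f -> Pt t v = phi (Pt 0 v - Pt 0 x0) + Pt t x0.
  by move=> vf; rewrite -(good_all f) // subrK.
have k1E : k1 = 1 - k2 - k3 by rewrite -k123; ring.
rewrite (moved a) // (moved b) // (moved c) // k1E.
rewrite (_ : (1 - k2 - k3) *: Pt 0 a + k2 *: Pt 0 b + k3 *: Pt 0 c - Pt 0 x0 =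
  (1 - k2 - k3) *: (Pt 0 a - Pt 0 x0) + k2 *: (Pt 0 b - Pt 0 x0)
  + k3 *: (Pt 0 c - Pt 0 x0)); last by apply/rowP => i; rewrite !mxE; ring.
move: (Pt 0 a - Pt 0 x0) (Pt 0 b - Pt 0 x0) (Pt 0 c - Pt 0 x0) => A B C.
rewrite !(proper_rotationD _ _ rot) !(proper_rotationZ _ _ rot).
by apply/rowP => i; rewrite !mxE; ring.
Qed.
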